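(* Let $V$ be a uniformly presented vector space. Then $V$ has a finite leftward resolution by sums of Schur projectives and various $D_k$: there are an integer $m\ge 0$ and an exact sequence of $\mathcal F$-representations $$0\longrightarrow Q_m\longrightarrow\cdots\longrightarrow Q_1\longrightarrow Q_0\longrightarrow V\longrightarrow 0$$ in which each $Q_i$ is a direct sum of Schur projectives and of copies of representations $D_k$ (for various $k\ge 0$).
   Context: Conventions: maps act on the right, so for $f:X\to Y$, $g:Y\to Z$ the composite is written $fg:X\to Z$. $\mathcal F$ is the category with objects the finite sets $[k]=\{1,\dots,k\}$, $k\ge 0$, and all functions as morphisms. $\mathcal V$ is the category of finite-dimensional $\mathbb Q$-vector spaces. An $\mathcal F$-representation is a functor $V:\mathcal F\to\mathcal V$; these form the category $\mathcal V^{\mathcal F}$ with natural transformations as morphisms; kernels, cokernels, exactness are objectwise. $\mathcal S_k$ is the symmetric group. $\mathbb Q\mathcal F$: objects are finite formal direct sums of objects of $\mathcal F$; $\mathbb Q\mathcal F([p],[q])$ is the free $\mathbb Q$-vector space on functions $[p]\to[q]$, with bilinear composition; morphisms between direct sums are matrices, composed by matrix multiplication. For an object $X$ of $\mathbb Q\mathcal F$, $\langle X\rangle=\mathbb Q\mathcal F(X,-)$, regarded as an $\mathcal F$-representation. For a morphism $f:X\to Y$ of $\mathbb Q\mathcal F$, $\langle f\rangle\subseteq\langle X\rangle$ is the image of $\mathbb Q\mathcal F(Y,-)\to\mathbb Q\mathcal F(X,-)$, $h\mapsto fh$. If $X\xrightarrow{f}Y\xrightarrow{g}Z$ are composable then $\langle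 fg\rangle\subseteq\langle f\rangle$. A uniformly presented vector space is an $\mathcal F$-representation given as a quotient $\langle f\rangle/\langle fg\rangle$ for composable morphisms $f,g$ of $\mathbb Q\mathcal F$. Schur projectives: let $\mathcal S$ be the groupoid of bijections in $\mathcal F$ (the disjoint union of the $\mathcal S_k$), and let $\mathbb S:\mathcal V^{\mathcal S}\to\mathcal V^{\mathcal F}$ (defined on $W$ of finite support) be left adjoint to restriction; explicitly $(\mathbb SW)(X)=\bigoplus_j \mathbb Q\mathcal F([j],X)\otimes_{\mathbb Q\mathcal S_j}W[j]$. A Schur projective of degree $k$ is a functor $\mathbb SW$ where $W\in\mathcal V^{\mathcal S}$ vanishes on sets of cardinality greater than $k$; a Schur projective is one of degree $k$ for some $k$. The representations $D_k$: let $\varepsilon_k=\frac1{k!}\sum_{\sigma\in\mathcal S_k}\operatorname{sign}(\sigma)\,\sigma\in\mathbb Q\mathcal F([k],[k])$, let $\iota_k:[k]\to[k+1]$ be the inclusion, and $\partial_k=\varepsilon_k\iota_k\varepsilon_{k+1}\in\mathbb Q\mathcal F([k],[k+1])$. Put $\Lambda^k=\langle\varepsilon_k\rangle$, let $d_k:\Lambda^{k+1}\to\Lambda^k$ be the map $h\mapsto\partial_k h$, and $D_k=\operatorname{coker}(d_k:\Lambda^{k+1}\to\Lambda^k)$ for $k\ge 0$. *)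

(* Defs.v *)
From HB Require Import structures.
From mathcomp Require Import all_boot all_order all_algebra all_fingroup.
From Stdlib Require List.
Set Implicit Arguments.
Unset Strict Implicit.
Unset Printing Implicit Defensive.
Import GRing.Theory.
Local Open Scope ring_scope.

(* Composites are written in diagrammatic order throughout: f first, then g.
   The set [k] is rendered as 'I_k = {0, .., k-1}. *)

Definition mor (p q : nat) := {ffun 'I_p -> 'I_q}.

Definition mor_id p : mor p p := [ffun x => x].

Definition mor_comp p q r (f : mor p q) (g : mor q r) : mor p r :=
  [ffun x => g (f x)].

Definition mor_perm k (s : 'S_k) : mor k k := [ffun x => s x].

Definition mor_incl k : mor k k.+1 := [ffun x => widen_ord (leqnSn k) x].

Lemma mor_compA p q r t (f : mor p q) (g : mor q r) (h : mor r t) :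
  mor_comp f (mor_comp g h) = mor_comp (mor_comp f g) h.
Proof. by apply/ffunP=> x; rewrite !ffunE. Qed.

Lemma mor_compf1 p q (f : mor p q) : mor_comp f (mor_id q) = f.
Proof. by apply/ffunP=> x; rewrite !ffunE. Qed.

Record Frep := MkFrep {
  rep_obj :> nat -> vectType rat;
  rep_map : forall p q, mor p q -> 'Hom(rep_obj p, rep_obj q);
  rep_map_id : forall p, rep_map (mor_id p) = \1%VF;
  rep_map_comp : forall p q r (f : mor p q) (g : mor q r),
    rep_map (mor_comp f g) = (rep_map g \o rep_map f)%VF
}.

Record Fhom (V W : Frep) := MkFhom {
  hom_app :> forall q, 'Hom(V q, W q);
  hom_natural : forall p q (a : mor p q),
    (hom_app q \o rep_map V a)%VF = (rep_map W a \o hom_app p)%VF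
}.

Definition rep_iso (V W : Frep) : Prop :=
  exists (f : Fhom V W) (g : Fhom W V), forall q,
    (g q \o f q)%VF = \1%VF /\ (f q \o g q)%VF = \1%VF.

Definition exact_at (U V W : Frep) (f : Fhom U V) (g : Fhom V W) : Prop :=
  forall q, limg (f q) = lker (g q).

Definition epi (V W : Frep) (f : Fhom V W) : Prop :=
  forall q, limg (f q) = fullv.

Definition rep_zero (V : Frep) : Prop := forall q, \dim {:V q} = 0%N.

Record subrep (V : Frep) := MkSubrep {
  sub_sp :> forall q, {vspace V q};
  sub_stable : forall p q (a : mor p q),
    (rep_map V a @: sub_sp p <= sub_sp q)%VS
}.

Lemma sub_stableP V (U : subrep V) p q (a : mor p q) (x : V p) :
  x \in U p -> rep_map V a x \in U q.
Proof. by move=> xU; apply: (subvP (sub_stable U a)); apply: memv_img. Qed.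

Section SubRep.
Variables (V : Frep) (U : subrep V).

Definition sub_obj q : vectType rat := subvs_of (U q).

Definition sub_map p q (a : mor p q) : 'Hom(sub_obj p, sub_obj q) :=
  (linfun (vsproj (U q)) \o rep_map V a \o linfun (@vsval _ _ (U p)))%VF.

Lemma sub_mapE p q (a : mor p q) (x : sub_obj p) :
  vsval (sub_map a x) = rep_map V a (vsval x).
Proof.
rewrite 2!comp_lfunE !lfunE /= vsprojK //.
exact/sub_stableP/subvsP.
Qed.

Lemma sub_map_id p : sub_map (mor_id p) = \1%VF.
Proof.
by apply/lfunP=> x; apply: val_inj; rewrite /= sub_mapE rep_map_id !id_lfunE.
Qed.

Lemma sub_map_comp p q r (f : mor p q) (g : mor q r) :
  sub_map (mor_comp f g) = (sub_map g \o sub_map f)%VF.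
Proof.
apply/lfunP=> x; apply: val_inj.
by rewrite /= comp_lfunE !sub_mapE rep_map_comp comp_lfunE.
Qed.

Definition sub_rep : Frep := MkFrep sub_map_id sub_map_comp.

(* V / U is carried by the complement of U chosen by the library;
   quot_pi is the quotient map. *)
Definition quot_obj q : vectType rat := subvs_of ((U q)^C)%VS.

Definition quot_pi q : 'Hom(V q, quot_obj q) :=
  (linfun (vsproj (U q)^C) \o daddv_pi (U q)^C (U q))%VF.

Lemma val_quot_pi q x : vsval (quot_pi q x) = daddv_pi (U q)^C (U q) x.
Proof. by rewrite comp_lfunE lfunE /= vsprojK // memv_pi. Qed.

Lemma quot_capC q : ((U q)^C :&: U q = 0)%VS.
Proof. by rewrite capvC capv_compl. Qed.

Lemma quot_pi_val q (y : quot_obj q) : quot_pi q (vsval y) = y.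
Proof.
apply: val_inj; rewrite /= val_quot_pi daddv_pi_id ?quot_capC //.
exact: subvsP.
Qed.

Lemma quot_pi_sub q x : x - vsval (quot_pi q x) \in U q.
Proof.
rewrite val_quot_pi -{1}[x](daddv_pi_add (quot_capC q)).
  by rewrite addrC addKr memv_pi.
by rewrite addvC addv_complf memvf.
Qed.

Lemma limg_quot_pi q : limg (quot_pi q) = fullv.
Proof.
apply/eqP; rewrite eqEsubv subvf /=; apply/subvP=> y _.
by rewrite -(quot_pi_val y) memv_img ?memvf.
Qed.

Lemma quot_pi_eq0 q x : (quot_pi q x == 0) = (x \in U q).
Proof.
apply/eqP/idP=> [x0|xU]; first by have := quot_pi_sub x; rewrite x0 linear0 addr0.
apply: val_inj; apply/eqP; change (vsval (quot_pi q x) == 0).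
rewrite -memv0 -(quot_capC q) memv_cap subvsP /=.
by have := memvB xU (quot_pi_sub x); rewrite subKr.
Qed.

Lemma quot_pi_eq q (x y : V q) : x - y \in U q -> quot_pi q x = quot_pi q y.
Proof.
move=> xyU; apply: (@subr0_eq (quot_obj q)).
by apply: etrans (esym (linearB (quot_pi q) x y)) _; apply/eqP; rewrite quot_pi_eq0.
Qed.

Definition quot_map p q (a : mor p q) : 'Hom(quot_obj p, quot_obj q) :=
  (quot_pi q \o rep_map V a \o linfun (@vsval _ _ (U p)^C))%VF.

Lemma quot_map_pi p q (a : mor p q) (x : V p) :
  quot_map a (quot_pi p x) = quot_pi q (rep_map V a x).
Proof.
rewrite 2!comp_lfunE [linfun _ (quot_pi p x)]lfunE; apply: quot_pi_eq.
rewrite -[_ - _](linearB (rep_map V a)) sub_stableP //.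
by rewrite -opprB memvN quot_pi_sub.
Qed.

Lemma quot_map_id p : quot_map (mor_id p) = \1%VF.
Proof.
by apply/lfunP=> x; rewrite -(quot_pi_val x) quot_map_pi rep_map_id !id_lfunE.
Qed.

Lemma quot_map_comp p q r (f : mor p q) (g : mor q r) :
  quot_map (mor_comp f g) = (quot_map g \o quot_map f)%VF.
Proof.
apply/lfunP=> x; rewrite -(quot_pi_val x) comp_lfunE !quot_map_pi.
by rewrite rep_map_comp comp_lfunE.
Qed.

Definition quot_rep : Frep := MkFrep quot_map_id quot_map_comp.

End SubRep.

Section HomImage.
Variables (V W : Frep) (f : Fhom V W).

Lemma hom_naturalE p q (a : mor p q) (x : V p) :
  f q (rep_map V a x) = rep_map W a (f p x).
Proof. by have /lfunP/(_ x) := hom_natural f a; rewrite !comp_lfunE. Qed.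

Lemma img_stable p q (a : mor p q) :
  (rep_map W a @: limg (f p) <= limg (f q))%VS.
Proof.
apply/subvP=> _ /memv_imgP[_ /memv_imgP[x _ ->] ->].
by rewrite -hom_naturalE memv_img ?memvf.
Qed.

Definition img : subrep W := MkSubrep img_stable.

Definition coker : Frep := quot_rep img.

End HomImage.

Section Restrict.
Variables (V W : Frep) (f : Fhom V W) (A : subrep V) (B : subrep W).
Hypothesis fAB : forall q, (f q @: A q <= B q)%VS.

Definition restr_app q : 'Hom(sub_rep A q, sub_rep B q) :=
  (linfun (vsproj (B q)) \o f q \o linfun (@vsval _ _ (A q)))%VF.

Lemma restr_appE q (x : sub_rep A q) : vsval (restr_app q x) = f q (vsval x).
Proof.
rewrite 2!comp_lfunE !lfunE /= vsprojK //.
by apply: (subvP (fAB q)); apply/memv_img/subvsP.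
Qed.

Lemma restr_natural p q (a : mor p q) :
  (restr_app q \o rep_map (sub_rep A) a)%VF =
  (rep_map (sub_rep B) a \o restr_app p)%VF.
Proof.
apply/lfunP=> x; apply: val_inj; rewrite /=.
rewrite (comp_lfunE (restr_app q)) (comp_lfunE (rep_map (sub_rep B) a)).
rewrite restr_appE [LHS](congr1 (f q) (sub_mapE _ _)).
by rewrite [RHS](sub_mapE a (restr_app p x)) restr_appE hom_naturalE.
Qed.

Definition restr_hom : Fhom (sub_rep A) (sub_rep B) := MkFhom restr_natural.

End Restrict.

(* sub_in is the preimage of W under the inclusion U -> V, that is W itself
   when W <= U (as in angle_comp_sub); subquot is then U / W. *)
Section Subquotient.
Variables (V : Frep) (U W : subrep V).

Definition sub_in_sp q : {vspace sub_rep U q} :=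
  (linfun (@vsval _ _ (U q)) @^-1: W q)%VS.

Lemma sub_in_spE q (x : sub_rep U q) : (x \in sub_in_sp q) = (vsval x \in W q).
Proof. by rewrite -memv_preim lfunE. Qed.

Lemma sub_in_stable p q (a : mor p q) :
  (rep_map (sub_rep U) a @: sub_in_sp p <= sub_in_sp q)%VS.
Proof.
apply/subvP=> _ /memv_imgP[x xW ->]; rewrite sub_in_spE in xW.
rewrite sub_in_spE (_ : vsval _ = rep_map V a (vsval x)) ?sub_stableP //.
exact: sub_mapE.
Qed.

Definition sub_in : subrep (sub_rep U) := MkSubrep sub_in_stable.

Definition subquot : Frep := quot_rep sub_in.

End Subquotient.

Section DirectSum.

Definition zero_obj (q : nat) : vectType rat := 'rV[rat]_0.

Lemma zero_map_id (p : nat) : (0 : 'Hom(zero_obj p, zero_obj p)) = \1%VF.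
Proof. by apply/lfunP=> x; apply/rowP=> -[]. Qed.

Lemma zero_map_comp (p q r : nat) (f : mor p q) (g : mor q r) :
  (0 : 'Hom(zero_obj p, zero_obj r)) =
  ((0 : 'Hom(zero_obj q, zero_obj r)) \o (0 : 'Hom(zero_obj p, zero_obj q)))%VF.
Proof. by apply/lfunP=> x; apply/rowP=> -[]. Qed.

Definition rep0 : Frep :=
  @MkFrep zero_obj (fun _ _ _ => 0) zero_map_id zero_map_comp.

Variables V W : Frep.

Definition sum_obj q : vectType rat := (V q * W q)%type.

Definition sum_fun p q (a : mor p q) (x : sum_obj p) : sum_obj q :=
  (rep_map V a x.1, rep_map W a x.2).

Lemma sum_fun_linear p q (a : mor p q) : linear (sum_fun a).
Proof. by move=> c x y; rewrite /sum_fun !linearP. Qed.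

HB.instance Definition _ p q (a : mor p q) :=
  GRing.isLinear.Build rat (sum_obj p) (sum_obj q) *:%R (sum_fun a)
    (sum_fun_linear a).

Definition sum_map p q (a : mor p q) : 'Hom(sum_obj p, sum_obj q) :=
  linfun (sum_fun a).

Lemma sum_map_id p : sum_map (mor_id p) = \1%VF.
Proof.
by apply/lfunP=> -[x y]; rewrite lfunE /= /sum_fun !rep_map_id !id_lfunE.
Qed.

Lemma sum_map_comp p q r (f : mor p q) (g : mor q r) :
  sum_map (mor_comp f g) = (sum_map g \o sum_map f)%VF.
Proof.
apply/lfunP=> -[x y]; rewrite comp_lfunE !lfunE /= /sum_fun.
by rewrite !rep_map_comp !comp_lfunE.
Qed.

Definition dsum2 : Frep := MkFrep sum_map_id sum_map_comp.

End DirectSum.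

Definition dsum (l : seq Frep) : Frep := foldr dsum2 rep0 l.

(* qhom0 p q is QF([p],[q]), a formal combination of functions being given by
   its coefficients. *)
Definition qhom0 (p q : nat) : vectType rat := {ffun mor p q -> rat^o}.

Definition qcomp0 p q r (f : qhom0 p q) (g : qhom0 q r) : qhom0 p r :=
  [ffun c => \sum_a \sum_(b | mor_comp a b == c) f a * g b].

Record qobj := MkQobj { nsum : nat; summand :> 'I_nsum -> nat }.

Definition single (k : nat) : qobj := MkQobj (fun _ : 'I_1 => k).

(* A matrix of elements of QF([X i],[Y j]) is stored as one family of
   coefficients, indexed by the triples (i, j, a) with a : [X i] -> [Y j]. *)
Definition qidx (X Y : qobj) : finType :=
  {ij : 'I_(nsum X) * 'I_(nsum Y) & mor (X ij.1) (Y ij.2)}.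

Definition qhom (X Y : qobj) : vectType rat := {ffun qidx X Y -> rat^o}.

Definition entry X Y i j (f : qhom X Y) : qhom0 (X i) (Y j) :=
  [ffun a => f (existT (fun ij => mor (X ij.1) (Y ij.2)) (i, j) a)].

Definition qcomp X Y Z (f : qhom X Y) (g : qhom Y Z) : qhom X Z :=
  [ffun u : qidx X Z =>
     (\sum_j qcomp0 (entry (tag u).1 j f) (entry j (tag u).2 g)) (tagged u)].

Definition qbasis p q (a : mor p q) : qhom (single p) (single q) :=
  [ffun u : qidx (single p) (single q) => ((tagged u : mor p q) == a)%:R].

Lemma entryP X Y (f g : qhom X Y) :
  (forall i j, entry i j f = entry i j g) -> f = g.
Proof.
move=> fg; apply/ffunP=> -[[i j] a].
by have /ffunP/(_ a) := fg i j; rewrite !ffunE.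
Qed.

Lemma entry_linear X Y i j : linear (@entry X Y i j).
Proof. by move=> c f g; apply/ffunP=> a; rewrite !ffunE. Qed.

Lemma entry_qcomp X Y Z (f : qhom X Y) (g : qhom Y Z) i k :
  entry i k (qcomp f g) = \sum_j qcomp0 (entry i j f) (entry j k g).
Proof. by apply/ffunP=> a; rewrite !ffunE. Qed.

Lemma qcomp0E p q r (f : qhom0 p q) (g : qhom0 q r) c :
  qcomp0 f g c = \sum_a \sum_b f a * g b * (mor_comp a b == c)%:R.
Proof.
rewrite ffunE; apply: eq_bigr => a _; rewrite big_mkcond /=.
by apply: eq_bigr => b _; case: eqP; rewrite ?mulr1 ?mulr0.
Qed.

Lemma qcomp0_linearl p q r (g : qhom0 q r) :
  linear (fun f : qhom0 p q => qcomp0 f g).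
Proof.
move=> c f f'; apply/ffunP=> x; rewrite !ffunE scaler_sumr -big_split /=.
apply: eq_bigr => a _; rewrite scaler_sumr -big_split /=.
by apply: eq_bigr => b _; rewrite !ffunE mulrDl scalerAl.
Qed.

Lemma qcomp0_linearr p q r (f : qhom0 p q) :
  linear (fun g : qhom0 q r => qcomp0 f g).
Proof.
move=> c g g'; apply/ffunP=> x; rewrite !ffunE scaler_sumr -big_split /=.
apply: eq_bigr => a _; rewrite scaler_sumr -big_split /=.
by apply: eq_bigr => b _; rewrite !ffunE mulrDr scalerAr.
Qed.

Definition qpost0 p q r (g : qhom0 q r) (f : qhom0 p q) : qhom0 p r :=
  qcomp0 f g.

HB.instance Definition _ p q r (g : qhom0 q r) :=
  GRing.isLinear.Build rat (qhom0 p q) (qhom0 p r) *:%R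
    (@qpost0 p q r g) (qcomp0_linearl g).

HB.instance Definition _ p q r (f : qhom0 p q) :=
  GRing.isLinear.Build rat (qhom0 q r) (qhom0 p r) *:%R
    (@qcomp0 p q r f) (qcomp0_linearr f).

HB.instance Definition _ X Y i j :=
  GRing.isLinear.Build rat (qhom X Y) (qhom0 (X i) (Y j)) *:%R
    (@entry X Y i j) (@entry_linear X Y i j).

Lemma qcomp0A p q r t (f : qhom0 p q) (g : qhom0 q r) (h : qhom0 r t) :
  qcomp0 f (qcomp0 g h) = qcomp0 (qcomp0 f g) h.
Proof.
apply/ffunP=> c; rewrite !qcomp0E.
transitivity (\sum_a \sum_b \sum_d
    f a * g b * h d * (mor_comp a (mor_comp b d) == c)%:R).
  apply: eq_bigr => a _.
  under eq_bigr => x _.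
    rewrite qcomp0E mulr_sumr mulr_suml.
    under eq_bigr => b _ do rewrite mulr_sumr mulr_suml.
    over.
  rewrite exchange_big /=; apply: eq_bigr => b _.
  rewrite exchange_big /=; apply: eq_bigr => d _.
  rewrite (bigD1 (mor_comp b d)) //= eqxx mulr1 big1 ?addr0 ?mulrA //.
  by move=> x /negPf xN; rewrite eq_sym xN !(mulr0, mul0r).
symmetry.
under eq_bigr => x _.
  under eq_bigr => d _.
    rewrite qcomp0E 2!mulr_suml.
    under eq_bigr => a _ do rewrite 2!mulr_suml.
    over.
  over.
under eq_bigr => x _ do rewrite exchange_big /=.
rewrite exchange_big /=; apply: eq_bigr => a _.
under eq_bigr => x _ do rewrite exchange_big /=.
rewrite exchange_big /=; apply: eq_bigr => b _.
rewrite exchange_big /=; apply: eq_bigr => d _.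
rewrite (bigD1 (mor_comp a b)) //= eqxx mulr1 big1 ?addr0 ?mor_compA //.
by move=> x /negPf xN; rewrite eq_sym xN !(mulr0, mul0r).
Qed.

Lemma qcompA X Y Z T (f : qhom X Y) (g : qhom Y Z) (h : qhom Z T) :
  qcomp f (qcomp g h) = qcomp (qcomp f g) h.
Proof.
apply: entryP => i l; rewrite !entry_qcomp.
under eq_bigr => j _.
  rewrite entry_qcomp linear_sum /=.
  under eq_bigr => k _ do rewrite qcomp0A.
  over.
rewrite exchange_big /=; apply: eq_bigr => k _.
by rewrite entry_qcomp -[RHS]/(qpost0 _ _) linear_sum.
Qed.

Lemma qcomp_linearl X Y Z (g : qhom Y Z) :
  linear (fun f : qhom X Y => qcomp f g).
Proof.
move=> c f f'; apply: entryP => i k.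
rewrite linearP /= !entry_qcomp.
rewrite scaler_sumr -big_split /=; apply: eq_bigr => j _.
rewrite linearP /=; exact: (linearP (qpost0 (entry j k g))).
Qed.

Lemma qcomp_linearr X Y Z (f : qhom X Y) :
  linear (fun g : qhom Y Z => qcomp f g).
Proof.
move=> c g g'; apply: entryP => i k.
rewrite linearP /= !entry_qcomp.
rewrite scaler_sumr -big_split /=; apply: eq_bigr => j _.
by rewrite !linearP.
Qed.

Definition qpost X Y Z (g : qhom Y Z) (f : qhom X Y) : qhom X Z := qcomp f g.

HB.instance Definition _ X Y Z (g : qhom Y Z) :=
  GRing.isLinear.Build rat (qhom X Y) (qhom X Z) *:%R
    (@qpost X Y Z g) (@qcomp_linearl X Y Z g).

HB.instance Definition _ X Y Z (f : qhom X Y) :=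
  GRing.isLinear.Build rat (qhom Y Z) (qhom X Z) *:%R
    (@qcomp X Y Z f) (@qcomp_linearr X Y Z f).

Lemma qcomp_qbasisE X q r (h : qhom X (single q)) (a : mor q r) i j c :
  entry i j (qcomp h (qbasis a)) c =
  \sum_(b | mor_comp b a == c) @entry X (single q) i (ord0 : 'I_1) h b.
Proof.
rewrite entry_qcomp big_ord1 qcomp0E [RHS]big_mkcond /=.
apply: eq_bigr => b _.
rewrite (bigD1 a) //= big1 ?addr0 => [|d /negPf dN].
  by rewrite !ffunE /= eqxx mulr1; case: eqP; rewrite ?mulr1 ?mulr0.
by rewrite !ffunE /= dN mulr0 mul0r.
Qed.

Lemma qcomp_id X q (h : qhom X (single q)) : qcomp h (qbasis (mor_id q)) = h.
Proof.
apply: entryP => i j; apply/ffunP=> c; rewrite qcomp_qbasisE (big_pred1 c).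
  by rewrite (ord1 j).
by move=> b; rewrite /= mor_compf1.
Qed.

Lemma qbasis_comp p q r (a : mor p q) (b : mor q r) :
  qcomp (qbasis a) (qbasis b) = qbasis (mor_comp a b).
Proof.
apply: entryP => i j; apply/ffunP=> c; rewrite qcomp_qbasisE big_mkcond /=.
rewrite (bigD1 a) //= big1 ?addr0 => [|d /negPf dN]; last first.
  by rewrite !ffunE /= dN if_same.
by rewrite !ffunE /= eqxx eq_sym; case: eqP.
Qed.

(* hull X is <X> and, below, angle f is <f>. *)
Section Hull.
Variable X : qobj.

Definition hull_obj q : vectType rat := qhom X (single q).

Definition hull_map p q (a : mor p q) : 'Hom(hull_obj p, hull_obj q) :=
  linfun (@qpost X _ _ (qbasis a)).

Lemma hull_map_id p : hull_map (mor_id p) = \1%VF.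
Proof. by apply/lfunP=> h; rewrite lfunE id_lfunE; exact: qcomp_id. Qed.

Lemma hull_map_comp p q r (f : mor p q) (g : mor q r) :
  hull_map (mor_comp f g) = (hull_map g \o hull_map f)%VF.
Proof.
by apply/lfunP=> h; rewrite comp_lfunE !lfunE /= /qpost -qbasis_comp qcompA.
Qed.

Definition hull : Frep := MkFrep hull_map_id hull_map_comp.

End Hull.

Section Precomp.
Variables (X Y : qobj) (f : qhom X Y).

Definition precomp_app q : 'Hom(hull Y q, hull X q) :=
  linfun (@qcomp X Y (single q) f).

Lemma precomp_natural p q (a : mor p q) :
  (precomp_app q \o rep_map (hull Y) a)%VF =
  (rep_map (hull X) a \o precomp_app p)%VF.
Proof. by apply/lfunP=> h; rewrite !comp_lfunE !lfunE /= /qpost qcompA. Qed.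

Definition precomp : Fhom (hull Y) (hull X) := MkFhom precomp_natural.

Definition angle : subrep (hull X) := img precomp.

End Precomp.

Definition uniformly_presented (V : Frep) : Prop :=
  exists (X Y Z : qobj) (f : qhom X Y) (g : qhom Y Z),
    rep_iso V (subquot (angle f) (angle (qcomp f g))).

Lemma angle_comp_sub X Y Z (f : qhom X Y) (g : qhom Y Z) q :
  (angle (qcomp f g) q <= angle f q)%VS.
Proof.
apply/subvP=> _ /memv_imgP[h _ ->]; rewrite lfunE /= -qcompA.
apply/memv_imgP; exists (qcomp g h); first exact: memvf.
by rewrite lfunE.
Qed.

(* An object of V^S: a representation of each symmetric group.  In the library
   s * t is s followed by t, so functoriality reads as follows. *)
Record Srep := MkSrep {
  srep_obj :> nat -> vectType rat;
  srep_act : forall j, 'S_j -> 'Hom(srep_obj j, srep_obj j);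
  srep_act1 : forall j, srep_act (1%g : 'S_j) = \1%VF;
  srep_actM : forall j (s t : 'S_j),
    srep_act (s * t)%g = (srep_act t \o srep_act s)%VF
}.

Section SchurPiece.
Variables (W : Srep) (j : nat).

(* QF([j],[q]) (x) W[j] over Q: the function t stands for the sum over a of
   a (x) t a. *)
Definition tens_obj q : vectType rat := {ffun mor j q -> W j}.

Definition tens_fun p q (b : mor p q) (t : tens_obj p) : tens_obj q :=
  [ffun c => \sum_(a | mor_comp a b == c) t a].

Lemma tens_fun_linear p q (b : mor p q) : linear (tens_fun b).
Proof.
move=> c s t; apply/ffunP=> x; rewrite !ffunE scaler_sumr -big_split /=.
by apply: eq_bigr => a _; rewrite !ffunE.
Qed.

HB.instance Definition _ p q (b : mor p q) :=
  GRing.isLinear.Build rat (tens_obj p) (tens_obj q) *:%R (tens_fun b)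
    (tens_fun_linear b).

Definition tens_map p q (b : mor p q) : 'Hom(tens_obj p, tens_obj q) :=
  linfun (tens_fun b).

Lemma tens_map_id p : tens_map (mor_id p) = \1%VF.
Proof.
apply/lfunP=> t; rewrite lfunE id_lfunE; apply/ffunP=> c; rewrite /= ffunE.
by rewrite (big_pred1 c) // => a; rewrite /= mor_compf1.
Qed.

Lemma tens_map_comp p q r (f : mor p q) (g : mor q r) :
  tens_map (mor_comp f g) = (tens_map g \o tens_map f)%VF.
Proof.
apply/lfunP=> t; rewrite comp_lfunE !lfunE; apply/ffunP=> c; rewrite /= !ffunE.
under [RHS]eq_bigr => x _ do rewrite ffunE.
rewrite (exchange_big_dep (fun a => mor_comp a (mor_comp f g) == c)) /=.
  apply: eq_bigr => a /eqP <-; rewrite (big_pred1 (mor_comp a f)) // => x.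
  rewrite /= mor_compA [RHS]eq_sym.
  by case: (mor_comp a f =P x) => [<-|_]; rewrite ?andbF ?eqxx.
by move=> x a /eqP <- /eqP <-; rewrite mor_compA.
Qed.

Definition tens : Frep := MkFrep tens_map_id tens_map_comp.

(* a (x) w |-> (s a) (x) w - a (x) (w s), the defining relations of the tensor
   product over Q S_j; s a is s followed by a. *)
Definition tens_rel_fun (s : 'S_j) q (t : tens_obj q) : tens_obj q :=
  [ffun a => t (mor_comp (mor_perm s^-1) a) - srep_act W s (t a)].

Lemma tens_rel_linear s q : linear (@tens_rel_fun s q).
Proof.
move=> c x y; apply/ffunP=> a; rewrite !ffunE linearP scalerBr /=.
by rewrite opprD addrACA.
Qed.

HB.instance Definition _ s q :=
  GRing.isLinear.Build rat (tens_obj q) (tens_obj q) *:%R (@tens_rel_fun s q)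
    (@tens_rel_linear s q).

Definition tens_rel_sp q : {vspace tens q} :=
  (\sum_(s : 'S_j) limg (linfun (@tens_rel_fun s q)))%VS.

Lemma mor_permK s q (a : mor j q) :
  mor_comp (mor_perm s) (mor_comp (mor_perm s^-1) a) = a.
Proof. by apply/ffunP=> x; rewrite !ffunE permK. Qed.

Lemma mor_permVK s q (a : mor j q) :
  mor_comp (mor_perm s^-1) (mor_comp (mor_perm s) a) = a.
Proof. by apply/ffunP=> x; rewrite !ffunE permKV. Qed.

Lemma tens_rel_natural s p q (b : mor p q) (t : tens_obj p) :
  tens_fun b (tens_rel_fun s t) = tens_rel_fun s (tens_fun b t).
Proof.
apply/ffunP=> c; rewrite !ffunE.
under eq_bigr => a _ do rewrite ffunE.
rewrite sumrB (linear_sum (srep_act W s)) /=; congr (_ - _).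
rewrite (reindex_onto (fun a => mor_comp (mor_perm s) a)
                      (fun a => mor_comp (mor_perm s^-1) a)) /=; last first.
  by move=> a _; rewrite mor_permK.
apply: eq_big => [a|a _]; last by rewrite mor_permVK.
rewrite mor_permVK eqxx andbT -mor_compA.
by apply/eqP/eqP => [<-|->]; rewrite ?mor_permVK ?mor_permK.
Qed.

Lemma tens_rel_stable p q (b : mor p q) :
  (rep_map tens b @: tens_rel_sp p <= tens_rel_sp q)%VS.
Proof.
rewrite limg_sum; apply/subv_sumP=> s _; apply: (subv_trans _ (sumv_sup s _ _)) => //.
apply/subvP=> _ /memv_imgP[_ /memv_imgP[t _ ->] ->].
rewrite !lfunE /= tens_rel_natural; apply/memv_imgP.
by exists (tens_fun b t); rewrite ?memvf ?lfunE.
Qed.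

Definition schur_piece : Frep := quot_rep (MkSubrep tens_rel_stable).

End SchurPiece.

(* The value on W of the left adjoint of restriction, for W vanishing in
   degrees > k. *)
Definition schur (W : Srep) (k : nat) : Frep :=
  dsum [seq schur_piece W j | j <- iota 0 k.+1].

Definition schur_projective_degree (k : nat) (V : Frep) : Prop :=
  exists W : Srep,
    (forall j, (k < j)%N -> \dim {:W j} = 0%N) /\ rep_iso V (schur W k).

Definition schur_projective (V : Frep) : Prop :=
  exists k, schur_projective_degree k V.

Definition eps (k : nat) : qhom (single k) (single k) :=
  (k`!%:R)^-1 *: \sum_(s : 'S_k) (-1) ^+ s *: qbasis (mor_perm s).

Definition partial (k : nat) : qhom (single k) (single k.+1) :=
  qcomp (qcomp (eps k) (qbasis (mor_incl k))) (eps k.+1).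

Definition Lambda (k : nat) : Frep := sub_rep (angle (eps k)).

Lemma partial_Lambda k q :
  (precomp (partial k) q @: angle (eps k.+1) q <= angle (eps k) q)%VS.
Proof.
apply/subvP=> _ /memv_imgP[h _ ->]; rewrite lfunE /= /partial -!qcompA.
by apply/memv_imgP; eexists; [exact: memvf | rewrite lfunE].
Qed.

Definition dmap (k : nat) : Fhom (Lambda k.+1) (Lambda k) :=
  restr_hom (@partial_Lambda k).

Definition Drep (k : nat) : Frep := coker (dmap k).

Definition schur_or_D (V : Frep) : Prop :=
  schur_projective V \/ exists k, rep_iso V (Drep k).

Definition sum_of_schur_and_D (V : Frep) : Prop :=
  exists l : seq Frep, List.Forall schur_or_D l /\ rep_iso V (dsum l).

(* Main.v *)
Require Import Defs.
From HB Require Import structures.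
From mathcomp Require Import all_boot all_order all_algebra all_fingroup.
From Stdlib Require List.
Set Implicit Arguments.
Unset Strict Implicit.
Unset Printing Implicit Defensive.
Import GRing.Theory Num.Theory.
Local Open Scope ring_scope.

(** Write M_{<r} for the part of M generated by the M(j) with j < r.  A
    uniformly presented V is a quotient of some <Y>, so V = V_{<k} for some k,
    and every such V is resolved by induction on k.  Three facts carry the
    induction.

    Products of differences.  Choose r points of [p] and, at each of them, two
    possible values; the alternating sum of the 2^r maps [p] -> [q] obtained in
    this way ([diff_prod]) kills the image of every map [j] -> [p] that misses
    one of the r points.  Hence all such sums kill every representation
    generated in degrees < r, and all its subrepresentations; this property is
    [polynomial_lt r].  Suitable choices of the values show, for such an M:
    for n > r the identity of M(n) is a combination of maps that factor through
    smaller sets, so that M is generated in degrees <= r and an element killed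
    by all maps to smaller sets is zero ([pol_gen_lt], [pol_detect]);
    permutations act on M(r) by their sign modulo M_{<r} ([pol_perm]); and
    alternating elements of M(n) vanish for n > r ([pol_alternating_eq0]).

    Splitting.  D_r is the representation generated by an alternating element
    of degree r whose image in degree r+1 has zero antisymmetrization
    ([Dgen_alternating], [Dgen_rel], [D_hom]).  So every alternating element of
    M(r) gives a map D_r -> M when M satisfies [polynomial_lt r].  As D_r
    satisfies [polynomial_lt r] itself for r > 0 ([pol_D]), vanishes below
    degree r and is spanned by its generator in degree r, injectivity of a map
    M_{<r} + D_r + ... + D_r -> M may be tested in degree r.  Adding copies of
    D_r one at a time therefore yields an isomorphism of M with the direct sum
    of M_{<r} and finitely many D_r, and a finite resolution of M_{<r} gives
    one of M ([resolvable_gen_lt]).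

    Minimal covers.  Let V = V_{<k+1}.  The Schur projective P built from
    stable complements of V_{<j}(j) in V(j), for j <= k, maps onto V
    ([schur_cover]).  Its kernel K satisfies [polynomial_lt k.+1], because P
    does, so it suffices to resolve K' = K_{<k+1}.  As the cover is minimal in
    degree k, K(k) lies in P_{<k}, hence K' is contained in P_{<k} and satisfies
    [polynomial_lt k].  It is thus enough to resolve K'_{<k}, which is generated
    in degrees < k, and the induction hypothesis applies
    ([resolvable_generated]). *)

Arguments hom_app : simpl never.
Arguments rep_map : simpl never.
Arguments rep_obj : simpl never.

(** * Homomorphisms, isomorphisms and exactness *)

Section BuildHom.
Variables (V W : Frep) (f : forall q, V q -> W q).
Arguments f : clear implicits.
Hypothesis f_lin : forall q, linear (f q).
Hypothesis f_nat : forall p q (a : mor p q) x,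
  f q (rep_map V a x) = rep_map W a (f p x).

Definition lfun_of q : 'Hom(V q, W q) :=
  linfun (HB.pack_for {linear V q -> W q} (f q)
            (GRing.isLinear.Build rat (V q) (W q) *:%R (f q) (@f_lin q))).

Lemma lfun_ofE q x : lfun_of q x = f q x.
Proof. by rewrite lfunE. Qed.

Lemma lfun_of_natural p q (a : mor p q) :
  (lfun_of q \o rep_map V a)%VF = (rep_map W a \o lfun_of p)%VF.
Proof. by apply/lfunP=> x; rewrite !comp_lfunE !lfun_ofE f_nat. Qed.

Definition build_hom : Fhom V W := MkFhom lfun_of_natural.

Lemma build_homE q x : build_hom q x = f q x.
Proof. exact: lfun_ofE. Qed.

End BuildHom.

Lemma rep_id (V : Frep) p (x : V p) : rep_map V (mor_id p) x = x.
Proof. by rewrite rep_map_id id_lfunE. Qed.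

Lemma rep_comp (V : Frep) p q r (f : mor p q) (g : mor q r) (x : V p) :
  rep_map V g (rep_map V f x) = rep_map V (mor_comp f g) x.
Proof. by rewrite rep_map_comp comp_lfunE. Qed.

Definition hom_id (V : Frep) : Fhom V V :=
  @build_hom V V (fun q (x : V q) => x) (fun q c x y => erefl) (fun p q a x => erefl).

Lemma hom_idE (V : Frep) q (x : V q) : hom_id V q x = x.
Proof. exact: build_homE. Qed.

Section Hcomp.
Variables (U V W : Frep) (g : Fhom V W) (f : Fhom U V).
Lemma hom_comp_lin q : linear (fun x : U q => g q (f q x)).
Proof. by move=> c x y; rewrite !linearP. Qed.
Lemma hom_comp_nat p q (a : mor p q) x :
  g q (f q (rep_map U a x)) = rep_map W a (g p (f p x)).
Proof. by rewrite !hom_naturalE. Qed.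
Definition hom_comp : Fhom U W := build_hom hom_comp_lin hom_comp_nat.
Lemma hom_compE q x : hom_comp q x = g q (f q x).
Proof. exact: build_homE. Qed.
End Hcomp.

Definition mono (V W : Frep) (f : Fhom V W) : Prop := forall q, injective (f q).

Lemma monoP (V W : Frep) (f : Fhom V W) :
  (forall q x, f q x = 0 -> x = 0) -> mono f.
Proof.
move=> f0 q x y fxy; apply/eqP; rewrite -subr_eq0; apply/eqP/f0.
by rewrite linearB /= fxy subrr.
Qed.

Lemma epiP (V W : Frep) (f : Fhom V W) :
  (forall q y, exists x, f q x = y) <-> epi f.
Proof.
split=> [f_surj q|f_epi q y].
  by apply/vspaceP=> y; rewrite memvf; have [x <-] := f_surj q y; rewrite memv_img ?memvf.
by have /memv_imgP[x _ ->] : y \in limg (f q) by [rewrite f_epi memvf]; exists x.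
Qed.

(** The objectwise inverse is natural because f is injective. *)
Lemma iso_bij (V W : Frep) (f : Fhom V W) : mono f -> epi f -> rep_iso V W.
Proof.
move=> f_inj f_epi.
have fK q : cancel (f q) ((f q)^-1)%VF by apply: lker0_lfunK; apply/lker0P/f_inj.
have fVK q : cancel ((f q)^-1)%VF (f q).
  by move=> y; apply: limg_lfunVK; rewrite f_epi memvf.
have g_lin q : linear ((f q)^-1)%VF by move=> c x y; rewrite linearP.
have g_nat p q (a : mor p q) x :
    ((f q)^-1)%VF (rep_map W a x) = rep_map V a (((f p)^-1)%VF x).
  by apply: (f_inj q); rewrite fVK hom_naturalE fVK.
exists f, (build_hom g_lin g_nat) => q.
by split; apply/lfunP=> x; rewrite comp_lfunE id_lfunE build_homE ?fK ?fVK.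
Qed.

Lemma iso_hom V W : rep_iso V W ->
  exists f : Fhom V W, mono f /\ epi f.
Proof.
case=> f [g fg]; exists f; split=> [q|].
  apply: (can_inj (g := g q)) => x.
  by have [/lfunP/(_ x)] := fg q; rewrite comp_lfunE id_lfunE.
apply/epiP=> q y; exists (g q y).
by have [_ /lfunP/(_ y)] := fg q; rewrite comp_lfunE id_lfunE.
Qed.

Lemma iso_refl V : rep_iso V V.
Proof.
apply: (@iso_bij _ _ (hom_id V)) => [q x y|]; first by rewrite !hom_idE.
by apply/epiP=> q y; exists y; rewrite hom_idE.
Qed.

Lemma iso_sym V W : rep_iso V W -> rep_iso W V.
Proof. by case=> f [g fg]; exists g, f => q; have [] := fg q. Qed.

Lemma rep_iso_comp U V W : rep_iso U V -> rep_iso V W -> rep_iso U W.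
Proof.
move=> /iso_hom[f [f_mono f_epi]] /iso_hom[g [g_mono g_epi]].
apply: (iso_bij (f := hom_comp g f)) => [q x y|].
  by rewrite !hom_compE => /g_mono/f_mono.
apply/epiP=> q z; have [y <-] := (epiP g).2 g_epi q z.
by have [x <-] := (epiP f).2 f_epi q y; exists x; rewrite hom_compE.
Qed.

Lemma exactP (U V W : Frep) (f : Fhom U V) (g : Fhom V W) :
  (forall q y, g q y = 0 <-> exists x, f q x = y) <-> exact_at f g.
Proof.
split=> [fg q|fg q y].
  apply/vspaceP=> y; rewrite memv_ker; apply/memv_imgP/eqP => [[x _ ->]|/fg[x <-]].
    by apply/fg; exists x.
  by exists x; rewrite ?memvf.
have -> : (g q y = 0) <-> (y \in limg (f q)).
  by rewrite fg memv_ker; split=> /eqP.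
by split=> [/memv_imgP[x _ ->]|[x <-]]; [exists x | rewrite memv_img ?memvf].
Qed.

(** * Subrepresentations, quotients and direct sums *)

Lemma sub_incl_lin V (U : subrep V) q : linear (fun x : sub_rep U q => vsval x : V q).
Proof. by move=> c x y; rewrite linearP. Qed.

Definition sub_incl V (U : subrep V) : Fhom (sub_rep U) V :=
  build_hom (@sub_incl_lin V U) (@sub_mapE V U).

Lemma sub_inclE V (U : subrep V) q (x : sub_rep U q) : sub_incl U q x = vsval x.
Proof. exact: build_homE. Qed.

Lemma sub_incl_mono V (U : subrep V) : mono (sub_incl U).
Proof. by move=> q x y; rewrite !sub_inclE => /val_inj. Qed.

Lemma quot_proj_lin V (U : subrep V) q : linear (fun x : V q => quot_pi U q x : quot_rep U q).
Proof. by move=> c x y; apply: linearP. Qed.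

Lemma quot_proj_nat V (U : subrep V) p q (a : mor p q) x :
  quot_pi U q (rep_map V a x) = rep_map (quot_rep U) a (quot_pi U p x).
Proof. exact: esym (quot_map_pi _ _ _). Qed.

Definition quot_proj V (U : subrep V) : Fhom V (quot_rep U) :=
  build_hom (@quot_proj_lin V U) (@quot_proj_nat V U).

Lemma quot_projE V (U : subrep V) q x : quot_proj U q x = quot_pi U q x.
Proof. exact: build_homE. Qed.

Lemma quot_proj_epi V (U : subrep V) : epi (quot_proj U).
Proof.
by apply/epiP=> q y; exists (vsval y); rewrite quot_projE; apply: quot_pi_val.
Qed.

Lemma quot_proj_eq0 V (U : subrep V) q x : quot_proj U q x = 0 <-> x \in U q.
Proof. by rewrite quot_projE -quot_pi_eq0; split=> /eqP. Qed.

(** Universal property of a quotient: a quotient is carried by a complement,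
    so the induced map is the restriction of g to that complement. *)
Section QuotHom.
Variables (V W : Frep) (U : subrep V) (g : Fhom V W).
Hypothesis gU : forall q x, x \in U q -> g q x = 0.

Lemma quot_hom_lin q : linear (fun y : quot_rep U q => g q (vsval y)).
Proof. by move=> c x y; rewrite -(linearP (g q)) -(linearP (@vsval _ _ (U q)^C%VS)). Qed.

Lemma quot_hom_val q x : g q (vsval (quot_pi U q x)) = g q x.
Proof.
apply/eqP; rewrite eq_sym -subr_eq0 -(linearB (g q)); apply/eqP/gU.
exact: quot_pi_sub.
Qed.

Lemma quot_hom_nat p q (a : mor p q) y :
  g q (vsval (rep_map (quot_rep U) a y)) = rep_map W a (g p (vsval y)).
Proof.
rewrite -{1}(quot_pi_val y) [rep_map _ a _]quot_map_pi quot_hom_val.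
exact: hom_naturalE.
Qed.

Definition quot_hom : Fhom (quot_rep U) W := build_hom quot_hom_lin quot_hom_nat.

Lemma quot_homE q x : quot_hom q (quot_proj U q x) = g q x.
Proof. by rewrite build_homE quot_projE quot_hom_val. Qed.
End QuotHom.

Lemma ker_stable V W (f : Fhom V W) p q (a : mor p q) :
  (rep_map V a @: lker (f p) <= lker (f q))%VS.
Proof.
apply/subvP=> _ /memv_imgP[x xf ->]; rewrite memv_ker in xf.
by rewrite memv_ker hom_naturalE (eqP xf) linear0.
Qed.
Definition ker_rep V W (f : Fhom V W) : subrep V := MkSubrep (ker_stable f).

Lemma preim_stable V W (f : Fhom V W) (U : subrep W) p q (a : mor p q) :
  (rep_map V a @: (f p @^-1: U p) <= (f q @^-1: U q))%VS.
Proof.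
apply/subvP=> _ /memv_imgP[x xf ->]; rewrite -memv_preim in xf.
by rewrite -memv_preim hom_naturalE; apply: sub_stableP.
Qed.
Definition preim_rep V W (f : Fhom V W) (U : subrep W) : subrep V :=
  MkSubrep (preim_stable f U).

Lemma preim_repE V W (f : Fhom V W) (U : subrep W) q x :
  (x \in preim_rep f U q) = (f q x \in U q).
Proof. by rewrite -memv_preim. Qed.

Section Corestriction.
Variables (V W : Frep) (f : Fhom V W).

Lemma corestr_val q x : vsval (vsproj (img f q) (f q x)) = f q x.
Proof. by rewrite vsprojK // memv_img ?memvf. Qed.

Lemma corestr_lin q : linear (fun x : V q => vsproj (img f q) (f q x) : sub_rep (img f) q).
Proof. by move=> c x y; rewrite !linearP. Qed.

Lemma corestr_nat p q (a : mor p q) (x : V p) :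
  vsproj (img f q) (f q (rep_map V a x)) =
  rep_map (sub_rep (img f)) a (vsproj (img f p) (f p x)).
Proof.
apply: val_inj; rewrite [RHS]sub_mapE /= [LHS]corestr_val.
by rewrite [in RHS]corestr_val hom_naturalE.
Qed.

Definition corestr : Fhom V (sub_rep (img f)) := build_hom corestr_lin corestr_nat.

Lemma corestrE q x : vsval (corestr q x) = f q x.
Proof. by rewrite build_homE corestr_val. Qed.

Lemma corestr_epi : epi corestr.
Proof.
apply/epiP=> q y; have /memv_imgP[x _ xy] := subvsP y.
by exists x; apply: val_inj; rewrite [LHS]corestrE -xy.
Qed.
End Corestriction.

Lemma zero_hom_lin (U V : Frep) q : linear (fun _ : U q => 0 : V q).
Proof. by move=> c x y; rewrite scaler0 addr0. Qed.
Lemma zero_hom_nat (U V : Frep) p q (a : mor p q) (x : U p) : 0 = rep_map V a 0.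
Proof. by rewrite linear0. Qed.
Definition zero_hom (U V : Frep) : Fhom U V :=
  build_hom (@zero_hom_lin U V) (@zero_hom_nat U V).

Section Sums.
Variables V W : Frep.

Lemma dsum2_mapE p q (a : mor p q) (x : V p) (y : W p) :
  rep_map (dsum2 V W) a (x, y) = (rep_map V a x, rep_map W a y).
Proof. by rewrite lfunE. Qed.

Lemma inl_lin q : linear (fun x : V q => (x, 0) : dsum2 V W q).
Proof. by move=> c x y; congr pair; rewrite /= scaler0 addr0. Qed.
Lemma inl_nat p q (a : mor p q) (x : V p) :
  (rep_map V a x, 0) = rep_map (dsum2 V W) a (x, 0).
Proof. by rewrite dsum2_mapE linear0. Qed.
Definition hom_inl : Fhom V (dsum2 V W) := build_hom inl_lin inl_nat.
Lemma hom_inlE q x : hom_inl q x = (x, 0).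
Proof. exact: build_homE. Qed.

Lemma inr_lin q : linear (fun x : W q => (0, x) : dsum2 V W q).
Proof. by move=> c x y; congr pair; rewrite /= scaler0 addr0. Qed.
Lemma inr_nat p q (a : mor p q) (x : W p) :
  (0, rep_map W a x) = rep_map (dsum2 V W) a (0, x).
Proof. by rewrite dsum2_mapE linear0. Qed.
Definition hom_inr : Fhom W (dsum2 V W) := build_hom inr_lin inr_nat.
Lemma hom_inrE q x : hom_inr q x = (0, x).
Proof. exact: build_homE. Qed.

Lemma dsum2_split q (x : dsum2 V W q) : x = hom_inl q x.1 + hom_inr q x.2.
Proof. by rewrite hom_inlE hom_inrE; case: x => x y; congr pair; rewrite /= ?addr0 ?add0r. Qed.

Variables (X : Frep) (f : Fhom V X) (g : Fhom W X).

Lemma copair_lin q : linear (fun x : dsum2 V W q => f q x.1 + g q x.2).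
Proof. by move=> c x y; rewrite !linearP /= scalerDr addrACA. Qed.
Lemma copair_nat p q (a : mor p q) (x : dsum2 V W p) :
  let y := rep_map (dsum2 V W) a x in
  f q y.1 + g q y.2 = rep_map X a (f p x.1 + g p x.2).
Proof. by case: x => x y; rewrite dsum2_mapE /= linearD !hom_naturalE. Qed.
Definition copair : Fhom (dsum2 V W) X := build_hom copair_lin copair_nat.
Lemma copairE q x : copair q x = f q x.1 + g q x.2.
Proof. exact: build_homE. Qed.
End Sums.

Definition hom_sum V V' W W' (f : Fhom V V') (g : Fhom W W') :
  Fhom (dsum2 V W) (dsum2 V' W') :=
  copair (hom_comp (hom_inl V' W') f) (hom_comp (hom_inr V' W') g).

Lemma hom_sumE V V' W W' (f : Fhom V V') (g : Fhom W W') q x :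
  hom_sum f g q x = (f q x.1, g q x.2).
Proof.
rewrite copairE !hom_compE hom_inlE hom_inrE.
by congr pair; rewrite /= ?addr0 ?add0r.
Qed.

Lemma iso_dsum2 U V V' : rep_iso V V' -> rep_iso (dsum2 U V) (dsum2 U V').
Proof.
move=> /iso_hom[f [f_mono f_epi]].
apply: (iso_bij (f := hom_sum (hom_id U) f)) => [q [x y] [x' y']|].
  by rewrite !hom_sumE !hom_idE /= => -[-> /f_mono->].
apply/epiP=> q [x y]; have [y' <-] := (epiP f).2 f_epi q y.
by exists (x, y'); rewrite hom_sumE hom_idE.
Qed.

(** * Generation in bounded degree *)

Definition gen_sp r (V : Frep) q : {vspace V q} :=
  (\sum_(j < r) \sum_(a : mor j q) limg (rep_map V a))%VS.

Lemma mem_gen_sp r (V : Frep) j q (a : mor j q) (x : V j) :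
  (j < r)%N -> rep_map V a x \in gen_sp r V q.
Proof.
move=> jr; rewrite -[j]/(val (Ordinal jr)) in a x *.
apply: (subvP (sumv_sup (Ordinal jr) isT (subvv _))).
by apply: (subvP (sumv_sup a isT (subvv _))); rewrite memv_img ?memvf.
Qed.

Lemma gen_sp_ind r (V : Frep) q (P : V q -> Prop) :
    P 0 -> (forall x y, P x -> P y -> P (x + y)) ->
    (forall j (a : mor j q) (x : V j), (j < r)%N -> P (rep_map V a x)) ->
  forall x, x \in gen_sp r V q -> P x.
Proof.
move=> P0 PD Pa _ /memv_sumP[vs vsP ->]; apply: big_ind => // j _.
have /memv_sumP[ws wsP ->] := vsP j isT; apply: big_ind => // a _.
by have /memv_imgP[x _ ->] := wsP a isT; apply: Pa.
Qed.

Lemma gen_stable r (V : Frep) p q (a : mor p q) :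
  (rep_map V a @: gen_sp r V p <= gen_sp r V q)%VS.
Proof.
apply/subvP=> _ /memv_imgP[x xr ->].
elim/gen_sp_ind: x / xr => [|x y xr yr|j b x jr].
- by rewrite linear0 mem0v.
- by rewrite linearD memvD.
- by rewrite rep_comp mem_gen_sp.
Qed.

Definition gen_lt r (V : Frep) : subrep V := MkSubrep (@gen_stable r V).

Definition generated_lt r (V : Frep) : Prop :=
  forall q (x : V q), x \in gen_lt r V q.

Lemma gen_lt_low r (V : Frep) j (x : V j) : (j < r)%N -> x \in gen_lt r V j.
Proof. by move=> jr; rewrite -(rep_id x) mem_gen_sp. Qed.

(** M_{<r} is the least subrepresentation that is everything below degree r;
    membership is nearly always used through this fact. *)
Lemma gen_lt_sub r (V : Frep) (U : subrep V) :
    (forall j (x : V j), (j < r)%N -> x \in U j) ->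
  forall q (x : V q), x \in gen_lt r V q -> x \in U q.
Proof.
move=> lowU q x; elim/gen_sp_ind: x / => [|x y xU yU|j b x jr].
- exact: mem0v.
- exact: memvD.
- exact/sub_stableP/lowU.
Qed.

Lemma gen_lt_hom r (V W : Frep) (f : Fhom V W) q (x : V q) :
  x \in gen_lt r V q -> f q x \in gen_lt r W q.
Proof.
move=> xr; rewrite -preim_repE; apply: gen_lt_sub xr => j y jr.
by rewrite preim_repE gen_lt_low.
Qed.

Lemma generated_le r s (V : Frep) :
  (r <= s)%N -> generated_lt r V -> generated_lt s V.
Proof.
move=> rs Vr q x; apply: gen_lt_sub (Vr q x) => j y jr.
exact/gen_lt_low/(leq_trans jr).
Qed.

Lemma generated_epi r (V W : Frep) (f : Fhom V W) :
  epi f -> generated_lt r V -> generated_lt r W.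
Proof. by move=> /epiP f_epi Vr q y; have [x <-] := f_epi q y; apply: gen_lt_hom. Qed.

Lemma generated_dsum2 r (V W : Frep) :
  generated_lt r V -> generated_lt r W -> generated_lt r (dsum2 V W).
Proof. by move=> Vr Wr q x; rewrite (dsum2_split x) memvD ?gen_lt_hom. Qed.

(** Generation of M_{<r} inside itself rather than inside M: the image in M
    of the subrepresentation that it generates contains all M(j), j < r. *)
Lemma generated_gen_lt r (V : Frep) : generated_lt r (sub_rep (gen_lt r V)).
Proof.
move=> q x; set U := gen_lt r (sub_rep _).
set f := hom_comp (sub_incl (gen_lt r V)) (sub_incl U).
have: vsval x \in img f q.
  apply: (@gen_lt_sub r V (img f)) (subvsP x) => j y jr.
  apply/memv_imgP; pose z := vsproj (gen_lt r V j) y : sub_rep (gen_lt r V) j.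
  exists (vsproj (U j) z); first exact: memvf.
  rewrite hom_compE !sub_inclE vsprojK ?gen_lt_low //.
  by rewrite /z vsprojK ?gen_lt_low.
case/memv_imgP=> y _; rewrite hom_compE !sub_inclE => /val_inj->.
exact: subvsP.
Qed.

(** * Products of differences *)

Definition mix p q (a b : mor p q) (S : {set 'I_p}) : mor p q :=
  [ffun i => if i \in S then b i else a i].

(** The action of the element of the tensor product of p copies of Q[q] whose
    factor is a i - b i at the points i of A, and a i at the others. *)
Definition diff_prod (V : Frep) p q (a b : mor p q) (A : {set 'I_p}) (x : V p) : V q :=
  \sum_(S : {set 'I_p} | S \subset A) (-1) ^+ #|S| *: rep_map V (mix a b S) x.

Lemma diff_prod_linear (V : Frep) p q (a b : mor p q) A :
  linear (@diff_prod V p q a b A).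
Proof.
move=> c x y; rewrite /diff_prod scaler_sumr -big_split; apply: eq_bigr => S _ /=.
by rewrite linearP scalerDr !scalerA mulrC.
Qed.

HB.instance Definition _ (V : Frep) p q (a b : mor p q) A :=
  GRing.isLinear.Build rat (V p) (V q) *:%R (@diff_prod V p q a b A)
    (diff_prod_linear a b A).

Lemma diff_prod_hom (V W : Frep) (f : Fhom V W) p q (a b : mor p q) A (x : V p) :
  f q (diff_prod a b A x) = diff_prod a b A (f p x).
Proof.
by rewrite linear_sum; apply: eq_bigr => S _; rewrite linearZ /= hom_naturalE.
Qed.

(** A form of being polynomial of degree < r: all products of r differences
    act as zero. *)
Definition polynomial_lt r (V : Frep) : Prop :=
  forall p q (a b : mor p q) (A : {set 'I_p}) (x : V p),
    (r <= #|A|)%N -> diff_prod a b A x = 0.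

(** Restricting a tensor along c augments the factors outside the image of c,
    and the augmentation of a difference is zero.  Concretely, adding the
    missed point i to S changes the sign and nothing else. *)
Lemma sum_mix_missed (M : lmodType rat) j p q (F : mor j q -> M)
    (c : mor j p) (a b : mor p q) (A : {set 'I_p}) i :
    i \in A -> (forall k, c k != i) ->
  \sum_(S : {set 'I_p} | S \subset A)
     (-1) ^+ #|S| *: F (mor_comp c (mix a b S)) = 0.
Proof.
move=> iA ci; rewrite (bigID (fun S : {set 'I_p} => i \in S)) /=.
rewrite (reindex_onto (fun S => i |: S) (fun S => S :\ i)) /=; last first.
  by move=> S /andP[_ iS]; rewrite setD1K.
rewrite (eq_bigl (fun S : {set 'I_p} => (S \subset A) && (i \notin S))); last first.
  move=> S; rewrite setU11 subUset sub1set iA /= andbT; congr andb.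
  apply/eqP/idP => [<-|iS]; first by rewrite setD11.
  by rewrite setU1K.
rewrite -big_split big1 //= => S /andP[_ iS].
rewrite cardsU1 iS exprS mulN1r scaleNr addrC; apply/eqP; rewrite subr_eq0; apply/eqP.
congr (_ *: F _); apply/ffunP=> k; rewrite !ffunE in_setU1.
by rewrite (negPf (ci k)).
Qed.

Lemma card_missed j p (c : mor j p) (A : {set 'I_p}) :
  (j < #|A|)%N -> exists2 i, i \in A & forall k, c k != i.
Proof.
move=> jA; have /subsetPn[i iA ic] : ~~ (A \subset c @: setT).
  apply: contraL jA => /subset_leq_card cA; rewrite -leqNgt (leq_trans cA) //.
  by rewrite (leq_trans (leq_imset_card _ _)) // cardsT card_ord.
exists i => // k; apply: contraNneq ic => <-; exact: imset_f.
Qed.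

Lemma diff_prod_missed (V : Frep) j p q (c : mor j p) (a b : mor p q)
    (A : {set 'I_p}) i (x : V j) :
  i \in A -> (forall k, c k != i) -> diff_prod a b A (rep_map V c x) = 0.
Proof.
move=> iA ci; rewrite -[RHS](sum_mix_missed (fun d => rep_map V d x) a b iA ci).
by apply: eq_bigr => S _; rewrite rep_comp.
Qed.

(** An image of [j] with j < r misses one of the r points of A. *)
Lemma pol_generated r (V : Frep) : generated_lt r V -> polynomial_lt r V.
Proof.
move=> Vr p q a b A x rA; move: (Vr p x); elim/gen_sp_ind: x / => [|x y x0 y0|j c x jr].
- exact: linear0.
- by rewrite linearD /= x0 y0 addr0.
have [i iA ci] := card_missed c (leq_trans jr rA).
exact: diff_prod_missed iA ci.
Qed.

Lemma pol_mono r (V W : Frep) (f : Fhom V W) :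
  mono f -> polynomial_lt r W -> polynomial_lt r V.
Proof.
move=> f_mono Wr p q a b A x rA; apply: (f_mono q).
by rewrite linear0 diff_prod_hom Wr.
Qed.

Lemma pol_sub r (V W : Frep) (f : Fhom V W) (U : subrep W) :
    mono f -> (forall q x, f q x \in U q) -> polynomial_lt r (sub_rep U) -> polynomial_lt r V.
Proof.
move=> f_mono fU U_pol p q a b A x rA; apply: (f_mono q).
pose y := vsproj (U p) (f p x) : sub_rep U p.
have -> : f q (diff_prod a b A x) = sub_incl U q (diff_prod a b A y).
  by rewrite (diff_prod_hom f) (diff_prod_hom (sub_incl U)) sub_inclE vsprojK ?fU.
by rewrite U_pol // !linear0.
Qed.

Lemma pol_dsum2 r (V W : Frep) :
  polynomial_lt r V -> polynomial_lt r W -> polynomial_lt r (dsum2 V W).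
Proof.
move=> Vr Wr p q a b A x rA.
by rewrite (dsum2_split x) linearD /= -!diff_prod_hom Vr // Wr // !linear0 addr0.
Qed.

(** * Alternating elements *)

Lemma mor_factor p q (f : mor p q) :
  exists (c : mor p #|f @: setT|) (d : mor #|f @: setT| q), f = mor_comp c d.
Proof.
have fP i : f i \in f @: setT by rewrite imset_f ?inE.
exists [ffun i => enum_rank_in (fP i) (f i)], [ffun k => enum_val k].
by apply/ffunP=> i; rewrite !ffunE enum_rankK_in.
Qed.

Lemma card_im_missed p q (f : mor p q) y :
  (forall i, f i != y) -> (#|f @: setT| < q)%N.
Proof.
move=> fy; rewrite -[X in (_ < X)%N]card_ord -cardsT; apply: proper_card.
rewrite properT; apply/eqP=> fT.
have /imsetP[i _ yi] : y \in f @: setT by rewrite fT inE.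
by have := fy i; rewrite -yi eqxx.
Qed.

Lemma gen_lt_missed (V : Frep) p r (f : mor p r) y (x : V p) :
  (forall i, f i != y) -> rep_map V f x \in gen_lt r V r.
Proof.
move=> fy; have [c [d f_cd]] := mor_factor f; rewrite {1}f_cd -rep_comp.
exact/mem_gen_sp/(card_im_missed fy).
Qed.

Definition alternating (V : Frep) n (x : V n) : Prop :=
  forall s : 'S_n, rep_map V (mor_perm s) x = (-1) ^+ s *: x.

Lemma mor_permM n (s t : 'S_n) :
  mor_perm (s * t) = mor_comp (mor_perm s) (mor_perm t).
Proof. by apply/ffunP=> i; rewrite !ffunE permM. Qed.

Lemma signrr (b : bool) : (-1) ^+ b * (-1) ^+ b = 1 :> rat.
Proof. by rewrite -expr2 sqrr_sign. Qed.

(** If c identifies i and j then c absorbs their transposition, so c x is its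
    own opposite. *)
Lemma alternating_noninj (V : Frep) n q (x : V n) (c : mor n q) i j :
  alternating x -> i != j -> c i = c j -> rep_map V c x = 0.
Proof.
move=> x_alt ij cij.
have c_tperm : mor_comp (mor_perm (tperm i j)) c = c.
  by apply/ffunP=> k; rewrite !ffunE; case: tpermP => [->|->|].
have := rep_comp (mor_perm (tperm i j)) c x.
rewrite c_tperm x_alt odd_tperm ij expr1 scaleN1r linearN /= => /eqP.
rewrite -subr_eq0 -opprD oppr_eq0 -mulr2n -scaler_nat scaler_eq0 pnatr_eq0 /=.
by move/eqP.
Qed.

Definition alternator (V : Frep) n (x : V n) : V n :=
  (n`!%:R)^-1 *: \sum_(s : 'S_n) (-1) ^+ s *: rep_map V (mor_perm s) x.

Lemma alternating_alternator (V : Frep) n (x : V n) : alternating (alternator x).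
Proof.
move=> t; rewrite /alternator linearZ linear_sum /= scalerA mulrC -scalerA.
congr (_ *: _); rewrite scaler_sumr (reindex_inj (mulIg (t^-1)%g)) /=.
apply: eq_bigr => s _; rewrite linearZ /= rep_comp -mor_permM mulgKV.
by rewrite odd_permM odd_permV signr_addb scalerA mulrC.
Qed.

Lemma fact_neq0 n : (n`!%:R : rat) != 0.
Proof. by rewrite pnatr_eq0 -lt0n fact_gt0. Qed.

Lemma sum_perm_const (M : zmodType) n (x : M) : \sum_(s : 'S_n) x = x *+ n`!.
Proof. by rewrite sumr_const -card_Sn. Qed.

Lemma alternator_id (V : Frep) n (x : V n) : alternating x -> alternator x = x.
Proof.
move=> x_alt; rewrite /alternator.
under eq_bigr => s _ do rewrite x_alt scalerA signrr scale1r.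
by rewrite sum_perm_const -scaler_nat scalerA mulVf ?scale1r ?fact_neq0.
Qed.

Section Expansion.
Variables (r : nat) (V : Frep).
Hypothesis V_pol : polynomial_lt r V.

(** The differences i - l at all points i other than l: the empty set
    contributes the identity, and every other S a map that is not onto. *)
Lemma pol_expansion n (l : 'I_n) (x : V n) : (r < n)%N ->
  x = - \sum_(S : {set 'I_n} | (S \subset [set~ l]) && (S != set0))
          (-1) ^+ #|S| *: rep_map V (mix (mor_id n) [ffun=> l] S) x.
Proof.
move=> rn; apply/eqP; rewrite -addr_eq0; apply/eqP.
have rA : (r <= #|[set~ l]|)%N by rewrite cardsC1 card_ord -ltnS (ltn_predK rn).
rewrite -[RHS](V_pol (mor_id n) [ffun=> l] x rA) /diff_prod [RHS](bigD1 set0) ?sub0set //=.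
congr (_ + _); rewrite cards0 scale1r.
suff -> : mix (mor_id n) [ffun=> l] set0 = mor_id n by rewrite rep_id.
by apply/ffunP=> i; rewrite !ffunE inE.
Qed.

Lemma mix_id_const_missed n (l : 'I_n) (S : {set 'I_n}) :
  S \subset [set~ l] -> S != set0 ->
  exists i, i != l /\ forall k, mix (mor_id n) [ffun=> l] S k != i.
Proof.
move=> Sl /set0Pn[i iS]; have := subsetP Sl i iS; rewrite !inE => il.
exists i; split=> // k; rewrite !ffunE.
by case: ifPn => [_|]; [rewrite eq_sym | apply: contraNneq => ->].
Qed.

Lemma pol_gen_lt n (x : V n) : (r < n)%N -> x \in gen_lt n V n.
Proof.
case: n x => // m x rn; rewrite (pol_expansion ord_max x rn) memvN.
apply: memv_suml => S /andP[Sl S0]; apply: memvZ.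
have [i [_ ci]] := mix_id_const_missed Sl S0.
exact: gen_lt_missed ci.
Qed.

Lemma pol_detect n (x : V n) : (r < n)%N ->
  (forall j (c : mor n j), (j < n)%N -> rep_map V c x = 0) -> x = 0.
Proof.
case: n x => // m x rn x0; rewrite (pol_expansion ord_max x rn).
apply/eqP; rewrite oppr_eq0 big1 // => S /andP[Sl S0].
have [i [_ ci]] := mix_id_const_missed Sl S0.
have [c [d ->]] := mor_factor (mix (mor_id m.+1) [ffun=> ord_max] S).
by rewrite -rep_comp x0 ?linear0 ?scaler0 ?(card_im_missed ci).
Qed.

(** In [pol_expansion] every map on the right identifies some i in S with l. *)
Lemma pol_alternating_eq0 n (x : V n) : (r < n)%N -> alternating x -> x = 0.
Proof.
case: n x => // m x rn x_alt; rewrite (pol_expansion ord_max x rn).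
apply/eqP; rewrite oppr_eq0 big1 // => S /andP[Sl /set0Pn[i iS]].
rewrite (alternating_noninj (i := i) (j := ord_max) x_alt) ?scaler0 //.
  by have := subsetP Sl i iS; rewrite !inE.
by rewrite !ffunE iS if_same.
Qed.

(** The differences i - j, j - i, and k - i at the remaining points k: the only
    bijective maps in the expansion are the identity and the transposition. *)
Lemma pol_tperm (i j : 'I_r) (x : V r) : i != j ->
  rep_map V (mor_perm (tperm i j)) x + x \in gen_lt r V r.
Proof.
move=> ij; pose b : mor r r := [ffun k => if k == i then j else i].
have := V_pol (mor_id r) b x (A := setT); rewrite cardsT card_ord leqnn => /(_ isT).
rewrite /diff_prod (bigD1 set0) ?sub0set // (bigD1 [set i; j]) /=; last first.
  by rewrite subsetT; apply/set0Pn; exists i; rewrite set21.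
rewrite cards0 cards2 ij sqrrN expr1n !scale1r.
have -> : mix (mor_id r) b set0 = mor_id r by apply/ffunP=> k; rewrite !ffunE inE.
have -> : mix (mor_id r) b [set i; j] = mor_perm (tperm i j).
  apply/ffunP=> k; rewrite !ffunE !inE; case: tpermP => [->|->|/eqP ki /eqP kj].
  - by rewrite eqxx.
  - by rewrite eqxx orbT eq_sym (negPf ij).
  - by rewrite (negPf ki) (negPf kj).
rewrite rep_id addrCA addrA => /eqP; rewrite addr_eq0 => /eqP->.
rewrite memvN; apply: memv_suml => S /andP[/andP[_ S0] Sij]; apply: memvZ.
suff [y Sy] : exists y, forall k, mix (mor_id r) b S k != y.
  exact: gen_lt_missed Sy.
(* A point of S that is not a value of b on S is missed by the mixed map. *)
suff [y yS Sy] : exists2 y, y \in S & forall k, k \in S -> b k != y.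
  exists y => k; rewrite !ffunE; case: ifPn => [kS|].
    by have := Sy k kS; rewrite ffunE.
  by apply: contraNneq => ->.
have [[k kS /norP[ki kj]]|S_sub] :
    (exists2 k, k \in S & ~~ ((k == i) || (k == j))) \/ S \subset [set i; j].
- case: (boolP (S \subset [set i; j])) => [|/subsetPn[k kS]]; first by right.
  by rewrite !inE; left; exists k.
- by exists k => // l _; rewrite ffunE; case: ifP => _; rewrite eq_sym.
have inS k : k \in S -> k = i \/ k = j.
  by move/(subsetP S_sub); rewrite !inE => /orP[]/eqP; [left|right].
have [iS|iS] := boolP (i \in S).
  exists i => // k kS; rewrite ffunE; case: (inS k kS) => kE; subst k.
    by rewrite eqxx eq_sym.
  case/eqP: Sij; apply/eqP; rewrite eqEsubset S_sub.
  by apply/subsetP=> l; rewrite !inE => /orP[]/eqP->.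
have [k kS] := set0Pn _ S0; case: (inS k kS) => kE; subst k; first by rewrite kS in iS.
exists j => // l lS; rewrite ffunE; case: (inS l lS) => lE; subst l.
  by rewrite lS in iS.
by rewrite [j == i]eq_sym (negPf ij).
Qed.

Lemma pol_perm (s : 'S_r) (x : V r) :
  rep_map V (mor_perm s) x - (-1) ^+ s *: x \in gen_lt r V r.
Proof.
have [ts -> ts_neq] := prod_tpermP s.
elim: ts ts_neq x => [_ x|[i j] ts IH /= /andP[/= ij ts_neq] x].
  rewrite big_nil odd_perm1 scale1r.
  have -> : mor_perm 1 = mor_id r by apply/ffunP=> i; rewrite !ffunE perm1.
  by rewrite rep_id subrr mem0v.
rewrite big_cons /= mor_permM -rep_comp odd_permM odd_tperm ij signr_addb expr1.
set t := (\prod_(_ <- ts) _)%g; set y := rep_map V (mor_perm (tperm i j)) x.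
rewrite mulN1r scaleNr opprK.
have -> : rep_map V (mor_perm t) y + (-1) ^+ t *: x =
  (rep_map V (mor_perm t) y - (-1) ^+ t *: y) + (-1) ^+ t *: (y + x).
  by rewrite scalerDr addrA subrK.
by rewrite memvD ?IH // memvZ // pol_tperm.
Qed.

Lemma pol_alternator (x : V r) : alternator x - x \in gen_lt r V r.
Proof.
have -> : alternator x - x = (r`!%:R)^-1 *:
    \sum_(s : 'S_r) (-1) ^+ s *: (rep_map V (mor_perm s) x - (-1) ^+ s *: x).
  under eq_bigr => s _ do rewrite scalerBr scalerA signrr scale1r.
  rewrite sumrB sum_perm_const scalerBr -scaler_nat scalerA.
  by rewrite mulVf ?scale1r ?fact_neq0.
by apply: memvZ; apply: memv_suml => s _; apply/memvZ/pol_perm.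
Qed.

End Expansion.

(** * The representations <X> *)

Definition hcoef p q (h : hull (single p) q) (a : mor p q) : rat :=
  @entry (single p) (single q) (ord0 : 'I_1) (ord0 : 'I_1) h a.

Lemma hull_expand p q (h : hull (single p) q) :
  h = \sum_(a : mor p q) hcoef h a *: qbasis a.
Proof.
apply: entryP => i j; rewrite linear_sum /= (ord1 i) (ord1 j).
apply/ffunP=> a; rewrite sum_ffunE (bigD1 a) //= big1 => [|b /negPf ba].
  by rewrite addr0 /hcoef !ffunE eqxx [RHS]mulr1.
by rewrite !ffunE /= eq_sym ba [LHS]mulr0.
Qed.

Section Yoneda.
Variables (V : Frep) (p : nat) (u : V p).

Definition yon_fun q (h : hull (single p) q) : V q :=
  \sum_(a : mor p q) hcoef h a *: rep_map V a u.

Lemma yon_lin q : linear (@yon_fun q).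
Proof.
move=> c x y; rewrite /yon_fun scaler_sumr -big_split; apply: eq_bigr => a _ /=.
by rewrite scalerA -scalerDl /hcoef !ffunE.
Qed.

HB.instance Definition _ q :=
  GRing.isLinear.Build rat (hull (single p) q) (V q) *:%R (@yon_fun q)
    (@yon_lin q).

Lemma yon_basis q (a : mor p q) : yon_fun (qbasis a) = rep_map V a u.
Proof.
rewrite /yon_fun (bigD1 a) //= big1 => [|b /negPf ba].
  by rewrite addr0 /hcoef !ffunE eqxx scale1r.
by rewrite /hcoef !ffunE /= ba scale0r.
Qed.

Lemma hull_mapE q r (a : mor q r) (h : hull (single p) q) :
  rep_map (hull (single p)) a h = qcomp h (qbasis a).
Proof. by rewrite lfunE. Qed.

Lemma yon_nat q r (a : mor q r) (h : hull (single p) q) :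
  yon_fun (rep_map (hull (single p)) a h) = rep_map V a (yon_fun h).
Proof.
rewrite {1}(hull_expand h) !linear_sum; apply: eq_bigr => b _.
by rewrite !linearZ /= hull_mapE qbasis_comp yon_basis rep_comp.
Qed.

Definition yon : Fhom (hull (single p)) V := build_hom yon_lin yon_nat.

Lemma yonE q h : yon q h = \sum_(a : mor p q) hcoef h a *: rep_map V a u.
Proof. exact: build_homE. Qed.

Lemma yon_qbasis q (a : mor p q) : yon q (qbasis a) = rep_map V a u.
Proof. by rewrite build_homE yon_basis. Qed.
End Yoneda.

(** Yoneda's lemma: f is determined by its value on the identity of [p]. *)
Lemma yon_hom (V : Frep) p (f : Fhom (hull (single p)) V) q h :
  f q h = yon (f p (qbasis (mor_id p))) q h.
Proof.
rewrite {1}(hull_expand h) linear_sum yonE; apply: eq_bigr => a _.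
rewrite linearZ -hom_naturalE hull_mapE qbasis_comp.
by congr (_ *: f q (qbasis _)); apply/ffunP=> i; rewrite !ffunE.
Qed.

Lemma precompE X Y (f : qhom X Y) q (h : hull Y q) : precomp f q h = qcomp f h.
Proof. by rewrite lfunE. Qed.

Lemma yon_qcomp (V : Frep) p q r (u : V p) (h : qhom (single p) (single q))
    (k : hull (single q) r) :
  yon u r (qcomp h k) = yon (yon u q h) r k.
Proof.
have := yon_hom (hom_comp (yon u) (precomp h)) k.
by rewrite !hom_compE !precompE qcomp_id.
Qed.

(** Through Yoneda's lemma, precomposition with eps p is antisymmetrization;
    this turns identities between elements of Q F into statements about
    alternating elements. *)
Lemma yon_eps (V : Frep) p (u : V p) : yon u p (eps p) = alternator u.
Proof.
rewrite linearZ linear_sum; congr (_ *: _); apply: eq_bigr => s _.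
by rewrite linearZ /= yon_qbasis.
Qed.

Lemma qcomp_eps p q (h : qhom (single p) (single q)) :
  qcomp h (eps q) = alternator (h : hull (single p) q).
Proof.
by have := yon_hom (precomp h) (eps q); rewrite !precompE qcomp_id => ->; rewrite yon_eps.
Qed.

Lemma qcomp1 p q (h : hull (single p) q) : qcomp (qbasis (mor_id p)) h = h.
Proof.
have -> : h = hom_id _ q h by rewrite hom_idE.
rewrite [RHS]yon_hom !hom_idE.
by have := yon_hom (precomp (qbasis (mor_id p))) h; rewrite !precompE qcomp_id.
Qed.

Lemma eps_alternator p :
  eps p = alternator (qbasis (mor_id p) : hull (single p) p).
Proof. by rewrite -qcomp_eps qcomp1. Qed.

Lemma eps_idem p : qcomp (eps p) (eps p) = eps p.
Proof.
rewrite qcomp_eps alternator_id // eps_alternator.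
exact: alternating_alternator.
Qed.

Definition qdelta X q (u : qidx X (single q)) : hull X q := [ffun v => (v == u)%:R].

Lemma hull_sum_qdelta X q (h : hull X q) :
  h = \sum_u (h : {ffun _ -> _}) u *: qdelta u.
Proof.
apply/ffunP=> v; rewrite sum_ffunE (bigD1 v) //= big1 => [|u /negPf uv].
  by rewrite addr0 !ffunE eqxx [RHS]mulr1.
by rewrite !ffunE eq_sym uv [LHS]mulr0.
Qed.

Definition qinj (X : qobj) q i (a : mor (X i) q) : qidx X (single q) :=
  existT (fun ij => mor (X ij.1) (single q ij.2)) (i, ord0 : 'I_1) a.

Lemma entry_qdelta (X : qobj) q i j (a b : mor (X i) q) :
  @entry X (single q) i j (qdelta (qinj a)) b = (b == a)%:R.
Proof.
rewrite !ffunE (ord1 j); congr (nat_of_bool _)%:R.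
by rewrite -tag_eqE /tag_eq eqxx tagged_asE.
Qed.

Lemma entry_qdelta_neq (X : qobj) q i i' j (a : mor (X i) q) b : i' != i ->
  @entry X (single q) i' j (qdelta (qinj a)) b = 0.
Proof.
move=> i'i; rewrite !ffunE (_ : (_ == _) = false) //.
by apply: contraNF i'i => /eqP/(congr1 tag) [->].
Qed.

Lemma qdelta_map (X : qobj) i q (a : mor (X i) q) :
  qdelta (qinj a) = rep_map (hull X) a (qdelta (qinj (mor_id (X i)))).
Proof.
rewrite lfunE; apply: entryP => i' j; apply/ffunP=> c; rewrite [RHS]qcomp_qbasisE.
have [i'i|i'i] := eqVneq i' i; last first.
  by rewrite entry_qdelta_neq // big1 // => b _; rewrite entry_qdelta_neq.
subst i'; rewrite entry_qdelta big_mkcond (bigD1 (mor_id _)) //= big1.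
  rewrite addr0 entry_qdelta eqxx (_ : mor_comp _ a = a) 1?eq_sym; first by case: eqP.
  by apply/ffunP=> k; rewrite !ffunE.
by move=> b /negPf b1; rewrite entry_qdelta b1 if_same.
Qed.

(** A matrix unit at a map a : [X i] -> [q] is the image under a of the matrix
    unit at the identity of [X i]. *)
Lemma generated_hull (X : qobj) : generated_lt (\max_i X i).+1 (hull X).
Proof.
move=> q h; rewrite (hull_sum_qdelta h); apply: memv_suml => -[[i j] a] _.
rewrite (ord1 j) in a *; rewrite memvZ // (qdelta_map a) mem_gen_sp //.
by rewrite ltnS (leq_bigmax i).
Qed.

(** * The representations D_r *)

(** D_r as a quotient of <[r]>: h is sent to the class of eps_r h. *)
Definition Dproj r : Fhom (hull (single r)) (Drep r) :=
  hom_comp (quot_proj (img (dmap r))) (corestr (precomp (eps r))).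

(** The class of eps_r, which generates D_r. *)
Definition Dgen r : Drep r r := Dproj r r (qbasis (mor_id r)).

Lemma Dproj_epi r : epi (Dproj r).
Proof.
apply/epiP=> q z; have [y <-] := (epiP _).2 (@quot_proj_epi _ (img (dmap r))) q z.
have [x <-] := (epiP _).2 (corestr_epi (precomp (eps r))) q y.
by exists x; rewrite hom_compE.
Qed.

Lemma Dproj_yon r q h : Dproj r q h = yon (Dgen r) q h.
Proof. exact: yon_hom. Qed.

Lemma Dgen_span r q (x : Drep r q) :
  exists c : mor r q -> rat, x = \sum_a c a *: rep_map (Drep r) a (Dgen r).
Proof.
have [h <-] := (epiP _).2 (Dproj_epi r) q x.
by exists (hcoef h); rewrite Dproj_yon yonE.
Qed.

Lemma Dproj_eq r q h h' : qcomp (eps r) h = qcomp (eps r) h' ->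
  Dproj r q h = Dproj r q h'.
Proof.
move=> hh'; rewrite !hom_compE; congr (quot_proj _ q _).
by apply: val_inj; rewrite [LHS]corestrE [RHS]corestrE !precompE.
Qed.

Lemma Dgen_alternating r : alternating (Dgen r).
Proof.
have -> : Dgen r = alternator (Dgen r); last exact: alternating_alternator.
rewrite -yon_eps -Dproj_yon; apply: Dproj_eq.
by rewrite eps_idem qcomp_id.
Qed.

Lemma dmapE r q (x : Lambda r.+1 q) :
  vsval (dmap r q x) = qcomp (partial r) (vsval x) :> hull (single r) q.
Proof. exact: etrans (restr_appE (@partial_Lambda r) x) (precompE _ _). Qed.

(** This is the relation divided out in D_r: eps_r iota_r eps_{r+1} is the image
    under d_r of eps_{r+1}, by idempotence of eps_{r+1}. *)
Lemma Dgen_rel r : alternator (rep_map (Drep r) (mor_incl r) (Dgen r)) = 0.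
Proof.
rewrite -yon_qbasis -yon_eps -yon_qcomp -Dproj_yon hom_compE.
apply/quot_proj_eq0/memv_imgP.
exists (corestr (precomp (eps r.+1)) r.+1 (qbasis (mor_id r.+1))); first exact: memvf.
apply: val_inj; rewrite [LHS]corestrE [RHS]dmapE [in RHS]corestrE !precompE.
by rewrite qcomp_id /partial -[RHS]qcompA eps_idem qcompA.
Qed.

(** The generator of D_r is the universal alternating element of degree r whose
    image in degree r+1 has zero antisymmetrization. *)
Section FromD.
Variables (V : Frep) (r : nat) (u : V r).
Hypothesis u_alt : alternating u.
Hypothesis u_rel : alternator (rep_map V (mor_incl r) u) = 0.

Lemma D_hom_rel q (x : Lambda r q) :
  x \in img (dmap r) q -> hom_comp (yon u) (sub_incl (angle (eps r))) q x = 0.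
Proof.
case/memv_imgP=> y _ ->; rewrite hom_compE sub_inclE dmapE.
rewrite yon_qcomp /partial yon_qcomp yon_qcomp !yon_eps yon_qbasis.
by rewrite (alternator_id u_alt) u_rel yonE big1 // => a _; rewrite linear0 scaler0.
Qed.

Definition D_hom : Fhom (Drep r) V := quot_hom D_hom_rel.

Lemma D_homE : D_hom r (Dgen r) = u.
Proof.
rewrite /Dgen hom_compE [LHS]quot_homE hom_compE sub_inclE corestrE precompE.
by rewrite qcomp_id yon_eps alternator_id.
Qed.
End FromD.

Lemma D_low r q (x : Drep r q) : (q < r)%N -> x = 0.
Proof.
move=> qr; have [c ->] := Dgen_span x; rewrite big1 // => a _.
have /injectivePn[i [j ij aij]] : ~~ injectiveb a.
  by apply: contraL qr => /injectiveP/leq_card; rewrite !card_ord leqNgt.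
by rewrite (alternating_noninj (@Dgen_alternating r) ij aij) scaler0.
Qed.

Lemma Dgen_span1 r (x : Drep r r) : exists c, x = c *: Dgen r.
Proof.
have [c ->] := Dgen_span x.
suff a_gen a : exists k, rep_map (Drep r) a (Dgen r) = k *: Dgen r.
  apply: (big_ind (fun x => exists k, x = k *: Dgen r)) => [|_ _ [k ->] [l ->]|a _].
  - by exists 0; rewrite scale0r.
  - by exists (k + l); rewrite scalerDl.
  - by have [k ->] := a_gen a; exists (c a * k); rewrite scalerA.
have [a_inj|/injectivePn[i [j ij aij]]] := boolP (injectiveb a); last first.
  by exists 0; rewrite (alternating_noninj (@Dgen_alternating r) ij aij) scale0r.
have -> : a = mor_perm (perm (injectiveP _ a_inj)).
  by apply/ffunP=> i; rewrite ffunE permE.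
by rewrite Dgen_alternating; eexists.
Qed.

Lemma mix_comp_inj j p q (c : mor j p) (a b : mor p q) (S : {set 'I_j}) :
  injective c -> mor_comp c (mix a b (c @: S)) = mix (mor_comp c a) (mor_comp c b) S.
Proof. by move=> c_inj; apply/ffunP=> i; rewrite !ffunE mem_imset. Qed.

(** When A is the image of c, no factor is augmented away: only the points of
    A survive, and they are relabelled by c. *)
Lemma diff_prod_inj (V : Frep) j p q (c : mor j p) (a b : mor p q) (x : V j) :
  injective c -> diff_prod a b (c @: setT) (rep_map V c x) =
                 diff_prod (mor_comp c a) (mor_comp c b) setT x.
Proof.
move=> c_inj; rewrite /diff_prod.
rewrite (reindex_onto (fun S : {set 'I_j} => c @: S)
                      (fun S : {set 'I_p} => c @^-1: S)) /=; last first.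
  move=> S /subsetP Sc; apply/setP=> y; apply/imsetP/idP => [[i]|yS].
    by rewrite inE => iS ->.
  by have /imsetP[i _ yi] := Sc y yS; exists i; rewrite ?inE -?yi.
apply: eq_big => [S|S _]; last by rewrite rep_comp mix_comp_inj // card_imset.
rewrite imsetS ?subsetT //=; apply/eqP/setP=> i.
by rewrite inE mem_imset.
Qed.

Lemma perm_fix_max n (s : 'S_n.+1) : s ord_max = ord_max ->
  exists t : 'S_n, s = lift_perm ord_max ord_max t.
Proof.
move=> s_max.
have sP i : exists j, s (lift ord_max i) = lift ord_max j.
  have : ord_max != s (lift ord_max i).
    by rewrite -{1}s_max (inj_eq perm_inj) neq_lift.
  by case/unlift_some=> j ->; exists j.
have f_ex i : exists j, s (lift ord_max i) == lift ord_max j.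
  by have [j /eqP] := sP i; exists j.
pose f i := xchoose (f_ex i).
have fP i : s (lift ord_max i) = lift ord_max (f i).
  exact/eqP/(xchooseP (f_ex i)).
have f_inj : injective f.
  by move=> i j fij; apply/(@lift_inj _ ord_max)/(@perm_inj _ s); rewrite !fP fij.
exists (perm f_inj); apply/permP=> i.
case: (unliftP ord_max i) => [j|] ->; last by rewrite lift_perm_id.
by rewrite lift_perm_lift permE fP.
Qed.

(** The product of the r differences a i - b i is a boundary.  Extend it by one
    more slot holding a single point, and apply it to the vanishing
    antisymmetrization of [Dgen_rel].  A permutation s that moves the last slot
    drops a slot carrying a difference and contributes zero; one that fixes it
    contributes the product itself, with sign cancelling that of s. *)
Lemma Dgen_diff_prod r q (a b : mor r q) : (0 < r)%N -> diff_prod a b setT (Dgen r) = 0.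
Proof.
move=> r_gt0; pose ext (f : mor r q) : mor r.+1 q :=
  [ffun k => if unlift ord_max k is Some i then f i else a (Ordinal r_gt0)].
have incl_inj : injective (mor_incl r).
  by move=> i j; rewrite !ffunE => /(congr1 val)/= ij; apply: val_inj.
have incl_lift i : mor_incl r i = lift ord_max i.
  by rewrite ffunE; apply: val_inj; rewrite /= /bump leqNgt ltn_ord.
have incl_ext f : mor_comp (mor_incl r) (ext f) = f.
  by apply/ffunP=> i; rewrite ffunE incl_lift ffunE liftK.
have incl_im : [set~ ord_max] = mor_incl r @: setT.
  apply/setP=> k; rewrite !inE; apply/idP/imsetP=> [k_max|[i _ ->]].
    case: (unliftP ord_max k) k_max => [i ->|->]; last by rewrite eqxx.
    by exists i; rewrite ?incl_lift.
  by rewrite incl_lift eq_sym neq_lift.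
set Z := diff_prod a b setT (Dgen r).
have sum_s (s : 'S_r.+1) : diff_prod (ext a) (ext b) [set~ ord_max]
      (rep_map (Drep r) (mor_comp (mor_incl r) (mor_perm s)) (Dgen r)) =
    if s ord_max == ord_max then (-1) ^+ s *: Z else 0.
  case: eqP => [/perm_fix_max[t ->]|s_max]; last first.
    apply: (@diff_prod_missed _ _ _ _ _ _ _ _ (s ord_max)); first by rewrite !inE; apply/eqP.
    by move=> k; rewrite !ffunE (inj_eq perm_inj) -[widen_ord _ _]ffunE
       -/(mor_incl r) incl_lift eq_sym neq_lift.
  have -> : mor_comp (mor_incl r) (mor_perm (lift_perm ord_max ord_max t)) =
            mor_comp (mor_perm t) (mor_incl r).
    apply/ffunP=> i; rewrite [LHS]ffunE incl_lift [RHS]ffunE incl_lift.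
    by rewrite !ffunE lift_perm_lift.
  rewrite -rep_comp Dgen_alternating linearZ linearZ /= incl_im.
  rewrite (diff_prod_inj _ _ _ incl_inj) 2!incl_ext odd_lift_perm.
  by rewrite addbb.
have := congr1 (diff_prod (ext a) (ext b) [set~ ord_max]) (Dgen_rel r).
rewrite linear0 linearZ linear_sum /= => /eqP; rewrite scaler_eq0 invr_eq0.
rewrite (negPf (fact_neq0 _)) /=.
under eq_bigr => s _ do rewrite linearZ /= rep_comp sum_s fun_if scaler0 scalerA
  signrr scale1r.
rewrite -big_mkcond /= sumr_const -scaler_nat scaler_eq0 pnatr_eq0 => /orP[|/eqP//].
rewrite -leqn0 leqNgt => /negP[]; apply/card_gt0P; exists 1%g.
by apply/eqP; rewrite perm1.
Qed.

(** For r = 0 the conclusion would say D_0 = 0, which is false.  On the image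
    under c of the generator, r differences survive only if c is injective onto
    the set A of their positions, which reduces to [Dgen_diff_prod]. *)
Lemma pol_D r : (0 < r)%N -> polynomial_lt r (Drep r).
Proof.
move=> r_gt0 p q a b A x rA; have [k ->] := Dgen_span x.
rewrite linear_sum big1 // => c _; rewrite linearZ /=.
suff -> : diff_prod a b A (rep_map (Drep r) c (Dgen r)) = 0 by rewrite scaler0.
have [A_c|/subsetPn[i iA ic]] := boolP (A \subset c @: setT); last first.
  apply: (diff_prod_missed _ _ _ iA) => l; apply: contraNneq ic => <-.
  by rewrite imset_f ?inE.
have c_card : (#|c @: setT| <= r)%N.
  by rewrite (leq_trans (leq_imset_card _ _)) // cardsT card_ord.
have A_im : A = c @: setT.
  by apply/eqP; rewrite eqEcard A_c (leq_trans c_card).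
have c_inj : injective c.
  have /imset_injP c_inj : #|c @: setT| == #|[set: 'I_r]|.
    rewrite cardsT card_ord eqn_leq c_card -A_im; exact: rA.
  by move=> i j; apply: c_inj; rewrite inE.
by rewrite A_im diff_prod_inj // Dgen_diff_prod.
Qed.

(** * Finite resolutions *)

Lemma sum_iso V W : sum_of_schur_and_D V -> rep_iso V W -> sum_of_schur_and_D W.
Proof.
by move=> [l [l_ok Vl]] VW; exists l; split=> //; apply: rep_iso_comp Vl; apply: iso_sym.
Qed.

Lemma sum_schur V : schur_projective V -> sum_of_schur_and_D V.
Proof.
move=> V_ok; exists [:: V]; split; first by constructor; [left | constructor].
apply: (iso_bij (f := hom_inl V rep0)) => [q x y|]; first by rewrite !hom_inlE => -[].
apply/epiP=> q [x y]; exists x; rewrite hom_inlE; congr pair.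
by apply/rowP=> -[].
Qed.

Lemma sum_D r V : sum_of_schur_and_D V -> sum_of_schur_and_D (dsum2 (Drep r) V).
Proof.
move=> [l [l_ok Vl]]; exists (Drep r :: l); split; last exact: iso_dsum2.
by constructor=> //; right; exists r; apply: iso_refl.
Qed.

Lemma sum_zero (V : Frep) : (forall q (x : V q), x = 0) -> sum_of_schur_and_D V.
Proof.
move=> V0; exists [::]; split; first by constructor.
apply: (iso_bij (f := zero_hom V rep0)) => [q x y _|].
  by rewrite (V0 q x) (V0 q y).
by apply/epiP=> q y; exists 0; apply/rowP=> -[].
Qed.

(** A finite resolution read from its right end: either V is itself allowed as
    a term, or it is covered by an allowed Q whose kernel K is resolvable. *)
Inductive resolvable : Frep -> Prop :=
| resolvable_sum V : sum_of_schur_and_D V -> resolvable V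
| resolvable_step V Q K (e : Fhom Q V) (i : Fhom K Q) :
    sum_of_schur_and_D Q -> epi e -> exact_at i e -> mono i -> resolvable K ->
    resolvable V.

Lemma resolvable_iso V W : resolvable V -> rep_iso V W -> resolvable W.
Proof.
case=> [{}V V_sum VW|{}V Q K e i Q_sum /epiP e_epi /exactP ie i_mono K_res].
  exact/resolvable_sum/(sum_iso V_sum).
case/iso_hom=> f [f_mono f_epi].
apply: (resolvable_step (e := hom_comp f e) Q_sum _ _ i_mono K_res).
  apply/epiP=> q z; have [y <-] := (epiP f).2 f_epi q z.
  by have [x <-] := e_epi q y; exists x; rewrite hom_compE.
apply/exactP=> q y; rewrite -ie hom_compE; split=> [fey|->]; last exact: linear0.
by apply: (f_mono q); rewrite fey linear0.
Qed.

(** D_r is added to the term that covers V, leaving the kernel unchanged, so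
    no lifting of maps out of D_r is needed. *)
Lemma resolvable_D r V : resolvable V -> resolvable (dsum2 (Drep r) V).
Proof.
case=> [{}V V_sum|{}V Q K e i Q_sum /epiP e_epi /exactP ie i_mono K_res].
  exact/resolvable_sum/sum_D.
have Q'_sum := sum_D r Q_sum.
apply: (resolvable_step (e := hom_sum (hom_id (Drep r)) e)
                        (i := hom_comp (hom_inr (Drep r) Q) i) Q'_sum) K_res.
- apply/epiP=> q [x y]; have [z <-] := e_epi q y.
  by exists (x, z); rewrite hom_sumE hom_idE.
- apply/exactP=> q [x y]; rewrite hom_sumE hom_idE; split=> [[-> /ie[z <-]]|[z]].
    by exists z; rewrite hom_compE hom_inrE.
  by rewrite hom_compE hom_inrE => -[<- <-]; rewrite (proj2 (ie q _)) //; exists z.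
- by move=> q x y; rewrite !hom_compE !hom_inrE => -[/i_mono].
Qed.

(** Induction on the codimension of f in degree r.  If f is not onto there, the
    antisymmetrization u of an element outside the image is still outside, as
    it differs from it by an element of M_{<r}; u extends f to D_r + B.  The
    extension is injective: below degree r as D_r vanishes, in degree r because
    u is outside the image of f, and above by [pol_detect]. *)
Lemma resolvable_absorb_D r (M B : Frep) (f : Fhom B M) :
    (0 < r)%N -> polynomial_lt r M -> mono f ->
    (forall j (y : M j), (j < r)%N -> y \in img f j) ->
  resolvable B -> resolvable M.
Proof.
move=> r_gt0 M_pol; have [n] := ubnP (\dim {:M r} - \dim (limg (f r)))%N.
elim: n B f => // n IH B f dim_f f_mono f_low B_res.
have f_gen q (y : M q) : y \in gen_lt r M q -> y \in img f q.
  by apply: gen_lt_sub => j x; apply: f_low.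
have [f_full|] := boolP (fullv <= limg (f r))%VS.
  apply: (resolvable_iso B_res (iso_bij f_mono _)) => q.
  apply/eqP; rewrite eqEsubv subvf; apply/subvP=> y _; move: q y.
  apply: ltn_ind => q IHq y; have [qr|rq|qr] := ltngtP q r; first exact: f_low.
    by apply: (gen_lt_sub (U := img f)) (pol_gen_lt M_pol y rq) => j x jq; apply: IHq.
  by subst q; apply: (subvP f_full); apply: memvf.
case/subvPn=> x _ xf; pose u := alternator x.
have u_alt : alternating u by apply: alternating_alternator.
have uf : u \notin limg (f r).
  apply: contra xf => uf; rewrite -(subKr u x); apply: memvB => //.
  exact/f_gen/pol_alternator.
have u_rel : alternator (rep_map M (mor_incl r) u) = 0.
  by apply: (pol_alternating_eq0 M_pol) => //; apply: alternating_alternator.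
pose g := copair (D_hom u_alt u_rel) f.
have B_pol : polynomial_lt r B by apply: pol_mono f_mono M_pol.
have g_mono : mono g.
  apply: monoP; apply: ltn_ind => q IHq z gz0.
  have [qr|rq|qr] := ltngtP q r.
  - move: gz0; case: z => x' y; rewrite copairE /= (D_low x' qr) linear0 add0r.
    by move=> fy0; congr pair; apply: (f_mono q); rewrite fy0 linear0.
  - apply: (pol_detect (pol_dsum2 (pol_D r_gt0) B_pol) rq) => j c jq.
    by apply: IHq => //; rewrite hom_naturalE gz0 linear0.
  subst q; move: gz0; case: z => x' y; rewrite copairE /=.
  have [c ->] := Dgen_span1 x'; rewrite linearZ /= D_homE.
  have [-> | c0] := eqVneq c 0.
    by rewrite !scale0r add0r => fy0; congr pair; apply: (f_mono r); rewrite fy0 linear0.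
  move/eqP; rewrite addr_eq0 => /eqP cu; case/negP: uf.
  by rewrite -(scalerK c0 u) cu memvZ // memvN memv_img ?memvf.
have f_g q (y : M q) : y \in img f q -> y \in img g q.
  case/memv_imgP=> z _ ->; apply/memv_imgP; exists (0, z); first exact: memvf.
  by rewrite copairE /= linear0 add0r.
apply: (IH _ g) g_mono _ (resolvable_D r B_res); last first.
  by move=> j y jr; apply/f_g/f_low.
rewrite ltnS in dim_f; apply: leq_trans dim_f; apply: ltn_sub2l.
  rewrite ltnNge; apply: contraNN uf => full; have/eqP -> : limg (f r) == fullv.
    by rewrite eqEdim subvf.
  exact: memvf.
rewrite ltnNge; apply: contraNN uf => full; have/eqP -> : limg (f r) == limg (g r).
  by rewrite eqEdim full andbT; apply/subvP=> y; apply: f_g.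
apply/memv_imgP; exists (Dgen r, 0); first exact: memvf.
by rewrite copairE /= linear0 addr0 D_homE.
Qed.

Lemma resolvable_gen_lt r (M : Frep) :
  polynomial_lt r M -> resolvable (sub_rep (gen_lt r M)) -> resolvable M.
Proof.
case: r => [|r] M_pol M_res.
  apply/resolvable_sum/sum_zero => q x; have := M_pol q q (mor_id q) (mor_id q) set0 x.
  rewrite cards0 => /(_ isT); rewrite /diff_prod (big_pred1 set0) => [|S]; last exact: subset0.
  rewrite cards0 scale1r (_ : mix _ _ _ = mor_id q) ?rep_id //.
  by apply/ffunP=> i; rewrite !ffunE if_same.
apply: (@resolvable_absorb_D r.+1 M _ (sub_incl _)) M_res => //.
  exact: sub_incl_mono.
move=> j y jr; have yr := gen_lt_low y jr; apply/memv_imgP.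
exists (vsproj (gen_lt r.+1 M j) y); first exact: memvf.
by rewrite sub_inclE vsprojK.
Qed.

(** * Stable complements and the pieces of a Schur projective *)

(** Maschke's theorem: averaging a projection onto U(j) over S_j makes it
    equivariant, so that its kernel is a stable complement. *)
Section Complement.
Variables (V : Frep) (U : subrep V) (j : nat).

Definition avg_proj : 'End(V j) :=
  (j`!%:R)^-1 *: \sum_(s : 'S_j)
     (rep_map V (mor_perm s^-1) \o projv (U j) \o rep_map V (mor_perm s))%VF.

Lemma avg_projE x : avg_proj x = (j`!%:R)^-1 *: \sum_(s : 'S_j)
  rep_map V (mor_perm s^-1) (projv (U j) (rep_map V (mor_perm s) x)).
Proof.
rewrite scale_lfunE sum_lfunE; congr (_ *: _); apply: eq_bigr => s _.
by rewrite !comp_lfunE.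
Qed.

Lemma avg_proj_mem x : avg_proj x \in U j.
Proof.
rewrite avg_projE memvZ // memv_suml // => s _.
by rewrite sub_stableP // memv_proj.
Qed.

Lemma rep_permK (s : 'S_j) : cancel (rep_map V (mor_perm s)) (rep_map V (mor_perm s^-1)).
Proof.
move=> x; rewrite rep_comp -mor_permM mulgV -[RHS]rep_id; congr (rep_map V _ x).
by apply/ffunP=> i; rewrite !ffunE perm1.
Qed.

Lemma avg_proj_id x : x \in U j -> avg_proj x = x.
Proof.
move=> xU; rewrite avg_projE.
under eq_bigr => s _ do rewrite projv_id ?sub_stableP // rep_permK.
by rewrite sum_perm_const -scaler_nat scalerA mulVf ?scale1r ?fact_neq0.
Qed.

Lemma avg_proj_perm (t : 'S_j) x :
  avg_proj (rep_map V (mor_perm t) x) = rep_map V (mor_perm t) (avg_proj x).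
Proof.
rewrite !avg_projE linearZ /=; congr (_ *: _).
rewrite [RHS]linear_sum (reindex_inj (mulgI t^-1)%g) /=; apply: eq_bigr => s _.
by rewrite !rep_comp -!mor_permM mulKVg invMg invgK.
Qed.

Definition stable_compl : {vspace V j} := lker avg_proj.

Lemma stable_compl_perm (s : 'S_j) x :
  x \in stable_compl -> rep_map V (mor_perm s) x \in stable_compl.
Proof. by rewrite !memv_ker avg_proj_perm => /eqP->; rewrite linear0. Qed.

Lemma stable_compl_cap x : x \in stable_compl -> x \in U j -> x = 0.
Proof. by rewrite memv_ker => /eqP x0 /avg_proj_id <-. Qed.

Lemma stable_compl_add x : exists2 c, c \in stable_compl & x - c \in U j.
Proof.
exists (x - avg_proj x); last by rewrite subKr avg_proj_mem.
by rewrite memv_ker linearB /= [avg_proj (avg_proj x)]avg_proj_id ?avg_proj_mem ?subrr.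
Qed.
End Complement.

Section SubSrep.
Variables (V : Frep) (C : forall j, {vspace V j}).
Hypothesis C_perm : forall j (s : 'S_j) x,
  x \in C j -> rep_map V (mor_perm s) x \in C j.

Definition sub_srep_act j (s : 'S_j) : 'End(subvs_of (C j)) :=
  (linfun (vsproj (C j)) \o rep_map V (mor_perm s) \o linfun vsval)%VF.

Lemma sub_srep_actE j (s : 'S_j) (w : subvs_of (C j)) :
  vsval (sub_srep_act s w) = rep_map V (mor_perm s) (vsval w).
Proof. by rewrite !comp_lfunE !lfunE /= vsprojK // C_perm ?subvsP. Qed.

Lemma sub_srep_act1 j : sub_srep_act (1%g : 'S_j) = \1%VF.
Proof.
apply/lfunP=> w; apply: val_inj; rewrite [LHS]sub_srep_actE id_lfunE.
rewrite -[RHS]rep_id; congr (rep_map V _ _).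
by apply/ffunP=> i; rewrite !ffunE perm1.
Qed.

Lemma sub_srep_actM j (s t : 'S_j) :
  sub_srep_act (s * t)%g = (sub_srep_act t \o sub_srep_act s)%VF.
Proof.
apply/lfunP=> w; apply: val_inj; rewrite [LHS]sub_srep_actE comp_lfunE.
by rewrite [RHS]sub_srep_actE sub_srep_actE rep_comp mor_permM.
Qed.

Definition sub_srep : Srep := MkSrep sub_srep_act1 sub_srep_actM.
End SubSrep.

Definition tdelta (W : Srep) j q (a : mor j q) (w : W j) : tens W j q :=
  [ffun c => if c == a then w else 0].

Definition tens_rel (W : Srep) j : subrep (tens W j) :=
  MkSubrep (@tens_rel_stable W j).

(** The class of the tensor a (x) w. *)
Definition pure (W : Srep) j q (a : mor j q) (w : W j) : schur_piece W j q :=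
  quot_proj (tens_rel W j) q (tdelta a w).

Section Piece.
Variables (W : Srep) (j : nat).

Lemma tens_expand q (t : tens W j q) : t = \sum_a tdelta a (t a).
Proof.
apply/ffunP=> c; rewrite sum_ffunE (bigD1 c) //= big1 => [|a /negPf ac].
  by rewrite addr0 ffunE eqxx.
by rewrite ffunE eq_sym ac.
Qed.

Lemma tens_map_delta p q (b : mor p q) (a : mor j p) (w : W j) :
  rep_map (tens W j) b (tdelta a w) = tdelta (mor_comp a b) w.
Proof.
rewrite lfunE; apply/ffunP=> c; rewrite !ffunE.
under eq_bigr => d _ do rewrite ffunE.
rewrite big_mkcond (bigD1 a) //= eqxx big1 => [|d /negPf ->].
  by rewrite addr0 eq_sym.
by rewrite if_same.
Qed.

Lemma pure_map p q (b : mor p q) (a : mor j p) (w : W j) :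
  rep_map (schur_piece W j) b (pure a w) = pure (mor_comp a b) w.
Proof.
by rewrite /pure -hom_naturalE tens_map_delta.
Qed.

Lemma pure_perm q (s : 'S_j) (a : mor j q) (w : W j) :
  pure (mor_comp (mor_perm s) a) w = pure a (srep_act W s w).
Proof.
apply/eqP; rewrite -subr_eq0 -linearB; apply/eqP/quot_proj_eq0.
apply: (subvP (sumv_sup s isT (subvv _))); apply/memv_imgP.
exists (tdelta a w); first exact: memvf.
rewrite lfunE; apply/ffunP=> c; rewrite !ffunE; congr (_ - _).
  congr (if _ then w else 0); apply/eqP/eqP => [->|<-]; first by rewrite mor_permVK.
  by rewrite mor_permK.
by case: eqP => // _; rewrite linear0.
Qed.

Lemma pureD q (a : mor j q) (w w' : W j) : pure a (w + w') = pure a w + pure a w'.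
Proof.
rewrite /pure -linearD; congr (quot_proj _ _ _); apply/ffunP=> c; rewrite !ffunE.
by case: eqP => // _; rewrite addr0.
Qed.

Lemma piece_ind q (P : schur_piece W j q -> Prop) :
    P 0 -> (forall x y, P x -> P y -> P (x + y)) ->
    (forall (a : mor j q) (w : W j), P (pure a w)) ->
  forall x, P x.
Proof.
move=> P0 PD Ppure x.
have [t <-] := (epiP _).2 (@quot_proj_epi _ (tens_rel W j)) q x.
by rewrite (tens_expand t) linear_sum; apply: big_ind => // a _; apply: Ppure.
Qed.

Lemma generated_piece : generated_lt j.+1 (schur_piece W j).
Proof.
move=> q; apply: piece_ind => [|x y|a w]; [exact: mem0v | exact: memvD |].
have -> : a = mor_comp (mor_id j) a by apply/ffunP=> i; rewrite !ffunE.
by rewrite -pure_map mem_gen_sp.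
Qed.

(** Modulo lower degrees only tensors a (x) w with a bijective remain, and those
    can be written with a = id. *)
Lemma piece_top (x : schur_piece W j j) :
  exists w : W j, x - pure (mor_id j) w \in gen_lt j (schur_piece W j) j.
Proof.
elim/piece_ind: x => [|x y [w xw] [w' yw']|a w].
- exists 0; rewrite sub0r memvN (_ : pure _ _ = 0) ?mem0v //.
  by apply: (@addrI _ (pure (mor_id j) 0)); rewrite -pureD !addr0.
- by exists (w + w'); rewrite pureD opprD addrACA memvD.
have [a_inj|a_inj] := boolP (injectiveb a).
  exists (srep_act W (perm (injectiveP _ a_inj)) w); rewrite -pure_perm.
  rewrite (_ : mor_comp _ _ = a) ?subrr ?mem0v //.
  by apply/ffunP=> i; rewrite !ffunE permE.
exists 0; rewrite (_ : pure _ 0 = 0) ?subr0; last first.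
  by apply: (@addrI _ (pure (mor_id j) 0)); rewrite -pureD !addr0.
have -> : a = mor_comp (mor_id j) a by apply/ffunP=> i; rewrite !ffunE.
rewrite -pure_map; have [c [d ->]] := mor_factor a; rewrite -rep_comp mem_gen_sp //.
rewrite ltn_neqAle -[X in _ != X]card_ord -cardsT.
rewrite (leq_trans (leq_imset_card _ _)) ?cardsT ?card_ord // andbT.
apply: contraNneq a_inj => a_card; apply/injectiveP=> i k.
have /imset_injP a_inj : #|a @: setT| == #|[set: 'I_j]|.
  by rewrite a_card cardsT card_ord.
by apply: a_inj; rewrite inE.
Qed.
End Piece.

(** * Schur projectives covering a representation *)

Section PieceHom.
Variables (V : Frep) (C : forall j, {vspace V j}).
Hypothesis C_perm : forall j (s : 'S_j) x,
  x \in C j -> rep_map V (mor_perm s) x \in C j.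
Variable j : nat.
Let W := sub_srep C_perm.

(** The counit of the adjunction, a (x) w |-> a w. *)
Definition tens_eval q (t : tens W j q) : V q :=
  \sum_a rep_map V a (vsval (t a)).

Lemma tens_eval_lin q : linear (@tens_eval q).
Proof.
move=> c x y; rewrite /tens_eval scaler_sumr -big_split; apply: eq_bigr => a _ /=.
by rewrite !ffunE -[RHS](linearP (rep_map V a)).
Qed.

HB.instance Definition _ q :=
  GRing.isLinear.Build rat (tens W j q) (V q) *:%R (@tens_eval q) (@tens_eval_lin q).

Lemma tens_eval_delta q (a : mor j q) (w : W j) :
  tens_eval (tdelta a w) = rep_map V a (vsval w).
Proof.
rewrite /tens_eval (bigD1 a) //= big1 => [|b /negPf ba].
  by rewrite addr0 ffunE eqxx.
by rewrite ffunE ba linear0.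
Qed.

Lemma tens_eval_nat p q (b : mor p q) (t : tens W j p) :
  tens_eval (rep_map (tens W j) b t) = rep_map V b (tens_eval t).
Proof.
rewrite {1}(tens_expand t) linear_sum linear_sum [RHS]linear_sum.
apply: eq_bigr => a _ /=.
by rewrite tens_map_delta tens_eval_delta rep_comp.
Qed.

Definition tens_hom : Fhom (tens W j) V := build_hom tens_eval_lin tens_eval_nat.

Lemma tens_hom_rel q x : x \in tens_rel W j q -> tens_hom q x = 0.
Proof.
case/memv_sumP=> y y_im ->; rewrite linear_sum big1 // => s _.
have /memv_imgP[t _ ->] := y_im s isT; rewrite lfunE /= build_homE /tens_eval.
under eq_bigr => a _.
  rewrite ffunE (linearB vsval) (linearB (rep_map V a)).
  over.
rewrite sumrB; apply/eqP; rewrite subr_eq0; apply/eqP.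
rewrite (reindex_onto (fun a => mor_comp (mor_perm s) a)
                      (fun a => mor_comp (mor_perm s^-1) a)) /=; last first.
  by move=> a _; rewrite mor_permK.
apply: eq_big => [a|a _]; first by rewrite mor_permVK eqxx.
by rewrite mor_permVK (sub_srep_actE C_perm) rep_comp.
Qed.

Definition piece_hom : Fhom (schur_piece W j) V := quot_hom tens_hom_rel.

Lemma piece_hom_pure q (a : mor j q) (w : W j) :
  piece_hom q (pure a w) = rep_map V a (vsval w).
Proof. by rewrite quot_homE build_homE tens_eval_delta. Qed.

Lemma piece_hom_img (x : V j) : x \in C j -> x \in img piece_hom j.
Proof.
move=> xC; apply/memv_imgP; exists (pure (mor_id j) (vsproj (C j) x : W j)).
  exact: memvf.
by rewrite piece_hom_pure rep_id vsprojK.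
Qed.

(** By [piece_top], x is id (x) w modulo lower degrees, so w lies both in the
    complement C j and in V_{<j}. *)
Lemma piece_hom_top (x : schur_piece W j j) :
    (forall c, c \in C j -> c \in gen_lt j V j -> c = 0) ->
  piece_hom j x \in gen_lt j V j -> x \in gen_lt j (schur_piece W j) j.
Proof.
move=> C_cap xV; have [w xw] := piece_top x.
have w0 : vsval w = 0.
  apply: C_cap (subvsP w) _; have := memvB xV (gen_lt_hom piece_hom xw).
  by rewrite linearB /= subKr piece_hom_pure rep_id.
move: xw; rewrite (_ : pure _ w = 0) ?subr0 //.
have -> : w = 0 by apply: val_inj.
by apply: (@addrI _ (pure (mor_id j) (0 : W j))); rewrite -pureD !addr0.
Qed.
End PieceHom.

Section SumHom.
Variables (F : nat -> Frep) (V : Frep) (h : forall j, Fhom (F j) V).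

Fixpoint sum_hom (s : seq nat) : Fhom (dsum [seq F j | j <- s]) V :=
  if s is j :: s' then copair (h j) (sum_hom s') else zero_hom rep0 V.

Lemma sum_hom_img s j q (y : V q) :
  j \in s -> y \in img (h j) q -> y \in img (sum_hom s) q.
Proof.
move=> js /memv_imgP[x _ ->]; elim: s js => //= i s IH.
rewrite inE => /orP[/eqP<-|/IH/memv_imgP[z _ ->]]; apply/memv_imgP.
  by exists (x, 0); rewrite ?memvf // copairE /= linear0 addr0.
by exists (0, z); rewrite ?memvf // copairE /= linear0 add0r.
Qed.

Lemma generated_dsum r s :
  (forall j, j \in s -> generated_lt r (F j)) ->
  generated_lt r (dsum [seq F j | j <- s]).
Proof.
elim: s => [_ q x|j s IH Fs] /=; first by rewrite (_ : x = 0) ?mem0v //; apply/rowP=> -[].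
apply: generated_dsum2; first by apply: Fs; rewrite mem_head.
by apply: IH => i is_; apply: Fs; rewrite inE is_ orbT.
Qed.

Hypothesis F_gen : forall j, generated_lt j.+1 (F j).
Variable k : nat.
Hypothesis h_top : forall x, h k k x \in gen_lt k V k -> x \in gen_lt k (F k) k.

(** Only the summand of index k has elements of degree k outside the part
    generated below k.  The other components of x therefore map into V_{<k}, and
    as k occurs only once in s, so does the component of index k. *)
Lemma sum_hom_top s (x : dsum [seq F j | j <- s] k) :
    uniq s -> all (leq^~ k) s -> sum_hom s k x \in gen_lt k V k ->
  x \in gen_lt k (dsum [seq F j | j <- s]) k.
Proof.
have F_lt j : (j < k)%N -> generated_lt k (F j).
  by move=> jk; apply: generated_le (@F_gen j).
elim: s x => [x _ _ _|j s IH x] /=.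
  by rewrite (_ : x = 0) ?mem0v //; apply/rowP=> -[].
case/andP=> js s_uniq /andP[jk sk]; rewrite copairE => hx; rewrite (dsum2_split x).
suff [x1 x2] : x.1 \in gen_lt k (F j) k /\ x.2 \in gen_lt k (dsum [seq F i | i <- s]) k.
  by apply: memvD; [apply: (gen_lt_hom (hom_inl _ _)) x1 | apply: (gen_lt_hom (hom_inr _ _)) x2].
move: jk; rewrite leq_eqVlt => /orP[/eqP jk|jk].
  subst j; have x2 : x.2 \in gen_lt k (dsum [seq F i | i <- s]) k.
    apply: generated_dsum => i is_; apply: F_lt.
    rewrite ltn_neqAle (allP sk i is_) andbT.
    by apply: contraNneq js => <-.
  split=> //; apply: h_top.
  by have := memvB hx (gen_lt_hom (sum_hom s) x2); rewrite addrK.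
have x1 := F_lt j jk k x.1; split=> //; apply: IH => //.
by have := memvB hx (gen_lt_hom (h j) x1); rewrite addrC addKr.
Qed.
End SumHom.

(** The last property says that the cover is minimal in degree k: it is
    injective on the degree k part of P / P_{<k}.  Surjectivity holds degree by
    degree, since V(j) is the sum of V_{<j}(j) and its complement. *)
Lemma schur_cover k (V : Frep) : generated_lt k.+1 V ->
  exists (P : Frep) (f : Fhom P V),
    [/\ schur_projective P, generated_lt k.+1 P, epi f &
        forall x : P k, f k x \in gen_lt k V k -> x \in gen_lt k P k].
Proof.
move=> V_gen.
pose C j : {vspace V j} := if (j <= k)%N then stable_compl (gen_lt j V) j else 0%VS.
have C_perm j (s : 'S_j) x : x \in C j -> rep_map V (mor_perm s) x \in C j.
  rewrite /C; case: ifP => _; first exact: stable_compl_perm.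
  by rewrite memv0 => /eqP->; rewrite linear0 mem0v.
pose h j : Fhom (schur_piece (sub_srep C_perm) j) V := piece_hom C_perm j.
exists (schur (sub_srep C_perm) k), (sum_hom h (iota 0 k.+1)); split.
- exists k, (sub_srep C_perm); split; last exact: iso_refl.
  move=> j kj; rewrite [LHS]dimvf /dim /= /C leqNgt kj /=.
  exact: dimv0.
- apply: generated_dsum => j; rewrite mem_iota => jk.
  by apply: generated_le (@generated_piece _ j).
- set f := sum_hom _ _; suff f_low j (y : V j) : (j < k.+1)%N -> y \in img f j.
    move=> q; apply/eqP; rewrite eqEsubv subvf; apply/subvP=> y _.
    exact: (gen_lt_sub (U := img f) f_low) (V_gen q y).
  move: j y; apply: ltn_ind => j IH y jk.
  have [c cC yc] := stable_compl_add (gen_lt j V) y.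
  rewrite -(subrK c y) memvD //.
    by apply: (gen_lt_sub (U := img f)) yc => i x ij; apply/IH/(ltn_trans ij).
  apply: (sum_hom_img (j := j)); first by rewrite mem_iota.
  by apply: piece_hom_img; rewrite /C -ltnS jk.
move=> x; apply: sum_hom_top.
- by move=> j; apply: generated_piece.
- move=> y; apply: piece_hom_top => c.
  by rewrite /C leqnn; apply: stable_compl_cap.
- exact: iota_uniq.
- by apply/allP=> j; rewrite mem_iota.
Qed.

(** * The resolution *)

Lemma resolvable_generated k (V : Frep) : generated_lt k V -> resolvable V.
Proof.
elim: k V => [V V_gen|k IH V V_gen].
  apply/resolvable_sum/sum_zero => q x.
  by elim/gen_sp_ind: x / (V_gen q x) => [|x y -> ->|] //; rewrite addr0.
have [P [f [P_schur P_gen f_epi f_top]]] := schur_cover V_gen.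
pose K := sub_rep (ker_rep f); pose i := sub_incl (ker_rep f).
have i_mono : mono i by apply: sub_incl_mono.
apply: (resolvable_step (sum_schur P_schur) f_epi _ i_mono).
  apply/exactP=> q x; split=> [fx0|[y <-]]; last first.
    by rewrite sub_inclE; apply/eqP; rewrite -memv_ker; apply: subvsP.
  have xK : x \in ker_rep f q by rewrite memv_ker fx0.
  by exists (vsproj (ker_rep f q) x); rewrite sub_inclE vsprojK.
apply: (resolvable_gen_lt (r := k.+1)).
  exact: pol_mono i_mono (pol_generated P_gen).
set K' := sub_rep (gen_lt k.+1 K).
apply: (resolvable_gen_lt (r := k)); last exact/IH/generated_gen_lt.
apply: (@pol_sub _ _ _ (hom_comp i (sub_incl (gen_lt k.+1 K))) (gen_lt k P)).
- by move=> q x y; rewrite !hom_compE => /i_mono/sub_incl_mono.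
(* K' is contained in P_{<k}: an element of K of degree k maps to 0 in V, so
   minimality of the cover puts it in P_{<k}. *)
- move=> q x; rewrite hom_compE -preim_repE sub_inclE.
  apply: gen_lt_sub (subvsP x) => j y; rewrite preim_repE ltnS leq_eqVlt.
  case/orP=> [/eqP jk|]; last exact: gen_lt_low.
  subst j; apply: f_top; rewrite sub_inclE.
  by have := subvsP y; rewrite memv_ker => /eqP->; apply: mem0v.
exact/pol_generated/generated_gen_lt.
Qed.

Lemma generated_uniform (V : Frep) : uniformly_presented V ->
  exists k, generated_lt k V.
Proof.
case=> X [Y [Z [f [g VXY]]]]; exists (\max_i Y i).+1.
have [e [_ e_epi]] := iso_hom (iso_sym VXY).
apply: (generated_epi e_epi).
apply: (generated_epi (@quot_proj_epi _ _)).
apply: (generated_epi (corestr_epi (precomp f))).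
exact: generated_hull.
Qed.

Lemma resolvable_complex V : resolvable V ->
  exists (m : nat) (Q : nat -> Frep)
         (d : forall i : nat, Fhom (Q i.+1) (Q i)) (e : Fhom (Q 0) V),
    (forall i : nat, i <= m -> sum_of_schur_and_D (Q i))%N /\
    (forall i : nat, m < i -> rep_zero (Q i))%N /\
    epi e /\
    exact_at (d 0) e /\
    (forall i : nat, exact_at (d i.+1) (d i)).
Proof.
elim=> {V} [V V_sum|V Q0 K e i Q_sum e_epi ie i_mono _
              [m [Q [d [e' [Q_ok [Q_zero [e'_epi [de' dd]]]]]]]]].
  exists 0, (fun i => if i is 0 then V else rep0), (fun i => zero_hom _ _), (hom_id V).
  split; last split; last split; last split.
  - by case.
  - by case=> // i _ q; rewrite dimvf /dim /=.
  - by apply/epiP=> q y; exists y; rewrite hom_idE.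
  - apply/exactP=> q y; rewrite hom_idE; split=> [->|[x <-]].
      by exists 0; rewrite linear0.
    by rewrite build_homE.
  - move=> i; apply/exactP=> q y; split=> _; last by rewrite build_homE.
    by exists 0; apply/rowP=> -[].
(* The resolution of K is spliced along Q 0 -> K -> Q0. *)
pose Q' j := if j is j'.+1 then Q j' else Q0.
pose d' j := match j return Fhom (Q' j.+1) (Q' j) with
             | 0 => hom_comp i e' | j'.+1 => d j' end.
exists m.+1, Q', d', e; split; last split; last split => //; last split.
- by case=> [//|j]; apply: Q_ok.
- by case=> [//|j]; apply: Q_zero.
- apply/exactP=> q y; rewrite ((exactP i e).2 ie); split=> [[x <-]|[x <-]].
    have [z <-] := (epiP e').2 e'_epi q x.
    by exists z; rewrite hom_compE.
  by exists (e' q x); rewrite hom_compE.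
case=> [|j]; last exact: dd.
apply/exactP=> q y; rewrite hom_compE -((exactP (d 0%N) e').2 de').
split=> [iy|->]; last exact: linear0.
by apply: (i_mono q); rewrite iy linear0.
Qed.

Local Close Scope ring_scope.

Theorem theorem5p1 (V : Frep) (hV : uniformly_presented V) :
  exists (m : nat) (Q : nat -> Frep)
         (d : forall i : nat, Fhom (Q i.+1) (Q i)) (e : Fhom (Q 0) V),
    (forall i : nat, i <= m -> sum_of_schur_and_D (Q i)) /\
    (forall i : nat, m < i -> rep_zero (Q i)) /\
    epi e /\
    exact_at (d 0) e /\
    (forall i : nat, exact_at (d i.+1) (d i)).
Proof.
have [k V_gen] := generated_uniform hV.
exact/resolvable_complex/(resolvable_generated V_gen).
Qed.
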